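(* Let $\mathbb{K}$ be a field and let $L$ be a maximal atomistic lattice (with respect to $\mathbb{K}$) with $k$ atoms and $\operatorname{pdim}_Q L = k-2$. Then $\operatorname{spdim}_Q L \leq k-2$ and $\operatorname{spdim}_I L \leq k-1$.
   Context: All lattices are finite. For a nonzero proper monomial ideal $I$ in a polynomial ring $S=\mathbb{K}[X_1,\dots,X_n]$, $L_I$ is its lcm lattice: all least common multiples of subsets of the minimal monomial generators, ordered by divisibility. Every finite atomistic lattice $L$ with at least one atom is isomorphic to some $L_I$, and one sets $\operatorname{pdim}_Q L:=\operatorname{pdim}_S S/I$, $\operatorname{spdim}_Q L:=\operatorname{spdim}S/I$ and $\operatorname{spdim}_I L:=\operatorname{spdim}I$; these do not depend on the choice of $I$ (or $S$). The subscripts $Q$ and $I$ stand for ''quotient'' and ''ideal''. Here, for a finitely generated $\mathbb{Z}^n$-graded $S$-module $M$, a Stanley space of $M$ is a $\mathbb{K}[Z]$-submodule $\lambda\mathbb{K}[Z]\subseteq M$ ($\lambda\in M$ homogeneous, $Z\subseteq\{X_1,\dots,X_n\}$) that is free over $\mathbb{K}[Z]$; a Stanley decomposition is a finite family of Stanley spaces with $M\cong\bigoplus_i\lambda_i\mathbb{K}[Z_i]$ as multigraded vector spaces, of depth $\min_i|Z_i|$; $\operatorname{sdepth}M$ is the maximal depth of a Stanley decomposition and $\operatorname{spdim}M=n-\operatorname{sdepth}M$. A finite atomistic lattice $L$ is maximal if every atomistic lattice $L'\not\cong L$ with the same number of atoms that admits a surjective join-preserving map $L'\to L$ satisfies $\operatorname{pdim}_Q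 L'>\operatorname{pdim}_Q L$. *)

(* Defs.v *)
From HB Require Import structures.
From mathcomp Require Import all_boot all_order all_algebra.
From mathcomp Require Import ring_quotient generic_quotient.
From mathcomp Require Import boolp classical_sets.
From mathcomp Require Import mpoly.

Set Implicit Arguments.
Unset Strict Implicit.
Unset Printing Implicit Defensive.

Import Order.TTheory GRing.Theory.
Local Open Scope ring_scope.
Local Open Scope quotient_scope.

(* MathComp has R / I only as a ring; this makes it an R-module, through the
   projection R -> R / I. *)
Section QuotientModule.
Variables (R : comNzRingType) (I : idealr R).

Definition quot_scale (a : R) (x : {ideal_quot I}) : {ideal_quot I} :=
  \pi_{ideal_quot I} a * x.

Fact quot_scaleA a b x :
  quot_scale a (quot_scale b x) = quot_scale (a * b) x.
Proof. by rewrite /quot_scale mulrA rmorphM. Qed.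

Fact quot_scale1 : left_id 1 quot_scale.
Proof. by move=> x; rewrite /quot_scale rmorph1 mul1r. Qed.

Fact quot_scaleDr : right_distributive quot_scale +%R.
Proof. by move=> a x y; rewrite /quot_scale mulrDr. Qed.

Fact quot_scaleDl x : {morph quot_scale^~ x : a b / a + b}.
Proof. by move=> a b; rewrite /quot_scale rmorphD mulrDl. Qed.

HB.instance Definition _ := GRing.Zmodule_isLmodule.Build R (@Quotient.quot _ I)
  quot_scaleA quot_scale1 quot_scaleDr quot_scaleDl.

End QuotientModule.

Section IdealModule.
Variables (R : comNzRingType) (I : idealr R).

Record ideal_module := IdealModule { imval :> R; imvalP : imval \in (I : {pred R}) }.

HB.instance Definition _ := [isSub for imval].
HB.instance Definition _ := [Choice of ideal_module by <:].
HB.instance Definition _ := [SubChoice_isSubZmodule of ideal_module by <:].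

Definition im_scale (a : R) (x : ideal_module) : ideal_module :=
  IdealModule (idealMr a (imvalP x)).

Fact im_scaleA a b x : im_scale a (im_scale b x) = im_scale (a * b) x.
Proof. by apply: val_inj; rewrite /= mulrA. Qed.

Fact im_scale1 : left_id 1 im_scale.
Proof. by move=> x; apply: val_inj; rewrite /= mul1r. Qed.

Fact im_scaleDr : right_distributive im_scale +%R.
Proof. by move=> a x y; apply: val_inj; rewrite /= mulrDr. Qed.

Fact im_scaleDl x : {morph im_scale^~ x : a b / a + b}.
Proof. by move=> a b; apply: val_inj; rewrite /= mulrDl. Qed.

HB.instance Definition _ := GRing.Zmodule_isLmodule.Build R ideal_module
  im_scaleA im_scale1 im_scaleDr im_scaleDl.

End IdealModule.

Section ProjectiveDimension.
Variable R : nzRingType.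

Definition projective_module (P : lmodType R) : Prop :=
  forall (M N : lmodType R) (f : {linear M -> N}) (g : {linear P -> N}),
    (forall y, exists x, f x = y) ->
    exists h : {linear P -> M}, forall x, f (h x) = g x.

Definition exact_at (M1 M2 M3 : lmodType R)
    (f : {linear M1 -> M2}) (g : {linear M2 -> M3}) : Prop :=
  forall y, g y = 0 <-> exists x, f x = y.

(* 0 -> P p -> ... -> P 1 -> P 0 -> M -> 0 *)
Definition has_projective_resolution (M : lmodType R) (p : nat) : Prop :=
  exists (P : nat -> lmodType R) (d : forall i, {linear P i.+1 -> P i})
         (e : {linear P 0%N -> M}),
    [/\ forall i, projective_module (P i),
        forall i, (p < i)%N -> forall x : P i, x = 0,
        forall y, exists x, e x = y,
        exact_at (d 0%N) e &
        forall i, exact_at (d i.+1) (d i)].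

Definition is_pdim (M : lmodType R) (p : nat) : Prop :=
  has_projective_resolution M p /\
  forall q, has_projective_resolution M q -> (p <= q)%N.

End ProjectiveDimension.

Definition ideal_span (R : comNzRingType) (E : R -> Prop) (p : R) : Prop :=
  exists s : seq (R * R),
    (forall q, q \in s -> E q.2) /\ p = \sum_(q <- s) q.1 * q.2.

(* An [idealr] is proper by definition. *)
Record monomialIdeal (K : fieldType) (n : nat) := MonomialIdeal {
  mideal :> idealr {mpoly K[n]};
  mideal_neq0 : exists2 p, p \in (mideal : {pred _}) & p != 0;
  mideal_gen : exists E : 'X_{1..n} -> Prop, forall p,
    p \in (mideal : {pred _}) <->
    ideal_span (fun q => exists2 m, E m & q = 'X_[m]) p }.

Section Graded.
Variables (K : fieldType) (n : nat).
Local Notation S := {mpoly K[n]}.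

Definition mdegz (m : 'X_{1..n}) : {ffun 'I_n -> int} := [ffun i => (m i)%:Z].

(* K acts on an S-module through the constant polynomials. *)
Record zgrading (M : lmodType S) := ZGrading {
  hcomp : {ffun 'I_n -> int} -> M -> Prop;
  hcomp0 : forall g, hcomp g 0;
  hcomp_lin : forall g (c : K) x y,
    hcomp g x -> hcomp g y -> hcomp g (c%:MP *: x + y);
  hcompX : forall m g x, hcomp g x -> hcomp (mdegz m + g) ('X_[m] *: x);
  hcomp_span : forall x, exists (s : seq {ffun 'I_n -> int}) y,
    (forall g, hcomp g (y g)) /\ x = \sum_(g <- s) y g;
  hcomp_indep : forall (s : seq {ffun 'I_n -> int}) y,
    uniq s -> (forall g, hcomp g (y g)) -> \sum_(g <- s) y g = 0 ->
    {in s, forall g, y g = 0} }.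

Definition polyin (Z : {set 'I_n}) (p : S) : Prop :=
  forall m, m \in msupp p -> forall i, m i != 0%N -> i \in Z.

Section Stanley.
Variables (M : lmodType S) (G : zgrading M).

Definition homogeneous (x : M) : Prop := exists g, hcomp G g x.

Definition in_stanley (lam : M) (Z : {set 'I_n}) (x : M) : Prop :=
  exists2 p, polyin Z p & x = p *: lam.

Definition is_stanley_space (lam : M) (Z : {set 'I_n}) : Prop :=
  homogeneous lam /\ forall p, polyin Z p -> p *: lam = 0 -> p = 0.

(* The external direct sum of the spaces lam_i K[Z_i] is the set [D] of the
   tuples with i-th entry in lam_i K[Z_i]; [phi], relevant on [D] only, is an
   isomorphism of multigraded vector spaces from it to M. *)
Definition is_stanley_decomposition (r : nat) (lam : 'I_r -> M)
    (Z : 'I_r -> {set 'I_n}) : Prop :=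
  (forall i, is_stanley_space (lam i) (Z i)) /\
  exists phi : {ffun 'I_r -> M} -> M,
    let D (v : {ffun 'I_r -> M}) := forall i, in_stanley (lam i) (Z i) (v i) in
    [/\ forall (c : K) u v, D u -> D v ->
          phi (c%:MP *: u + v) = c%:MP *: phi u + phi v,
        forall g v, D v -> (forall i, hcomp G g (v i)) -> hcomp G g (phi v),
        forall u v, D u -> D v -> phi u = phi v -> u = v &
        forall x, exists2 v, D v & phi v = x].

Definition has_stanley_depth (s : nat) : Prop :=
  exists (r : nat) (lam : 'I_r -> M) (Z : 'I_r -> {set 'I_n}),
    [/\ is_stanley_decomposition lam Z,
        forall i, (s <= #|Z i|)%N &
        exists i, #|Z i| = s].

(* Every depth is at most n, so for M <> 0 this is the maximum of all depths. *)
Definition sdepth : nat := (\max_(s < n.+1 | `[< has_stanley_depth s >]) s)%N.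

Definition spdim : nat := (n - sdepth)%N.

End Stanley.

Definition hpoly (g : {ffun 'I_n -> int}) (p : S) : Prop :=
  forall m, m \in msupp p -> mdegz m = g.

Fact mdegz_inj : injective mdegz.
Proof.
by move=> m1 m2 /ffunP e; apply/mnmP => i; have := e i; rewrite !ffunE => -[].
Qed.

Fact mdegzD m1 m2 : mdegz (m1 + m2)%MM = mdegz m1 + mdegz m2.
Proof. by apply/ffunP => i; rewrite !ffunE mnmDE PoszD. Qed.

Fact hpoly0 g : hpoly g 0.
Proof. by move=> m; rewrite mcoeff_msupp mcoeff0 eqxx. Qed.

Fact hpoly_lin g (c : K) p q : hpoly g p -> hpoly g q -> hpoly g (c%:MP * p + q).
Proof.
move=> hp hq m; rewrite mcoeff_msupp mcoeffD mcoeffCM.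
have [/hp //|np] := boolP (m \in msupp p).
have [/hq //|nq] := boolP (m \in msupp q).
by rewrite (memN_msupp_eq0 np) (memN_msupp_eq0 nq) mulr0 addr0 eqxx.
Qed.

Fact hpolyX m g p : hpoly g p -> hpoly (mdegz m + g) ('X_[m] * p).
Proof.
move=> hp m'; rewrite mulrC (perm_mem (msuppMX p m)) => /mapP[m1 /hp <- ->].
by rewrite mdegzD.
Qed.

Fact hpoly_mono c m : hpoly (mdegz m) (c *: 'X_[m]).
Proof. by move=> m' /msuppZ_le; rewrite msuppX inE => /eqP->. Qed.

Fact hpoly_coeff (s : seq {ffun 'I_n -> int}) p g m :
  uniq s -> (forall h, hpoly h (p h)) -> g \in s -> m \in msupp (p g) ->
  m \in msupp (\sum_(h <- s) p h).
Proof.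
move=> us hp gs mg; rewrite mcoeff_msupp raddf_sum /= (bigD1_seq g) //=.
rewrite big1 ?addr0 -?mcoeff_msupp // => h hg; apply: memN_msupp_eq0.
by apply: contra hg => /hp <-; rewrite (hp _ _ mg).
Qed.

Section OfIdeal.
Variable I : monomialIdeal K n.

Fact mideal_msupp p m :
  p \in (I : {pred S}) -> m \in msupp p -> 'X_[m] \in (I : {pred S}).
Proof.
have [E IE] := mideal_gen I.
move=> /IE[s [sE ->]] /msupp_sum_le /flatten_mapP[/= [a b] abs].
move: abs; rewrite filter_predT => abs mab.
have [/= m1 Em1 b1] := sE _ abs; move: mab.
rewrite /= b1 (perm_mem (msuppMX a m1)) => /mapP[m2 _ ->].
rewrite addmC mpolyXD; apply: idealMr; apply/IE.
exists [:: (1, 'X_[m1])]; split; last by rewrite big_seq1 mul1r.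
by move=> q; rewrite inE => /eqP->; exists m1.
Qed.

Fact mideal_of_msupp p :
  (forall m, m \in msupp p -> 'X_[m] \in (I : {pred S})) -> p \in (I : {pred S}).
Proof.
move=> h; rewrite [p]mpolyE big_seq; apply: rpred_sum => m mp.
by rewrite -mul_mpolyC idealMr ?h.
Qed.

Definition ihcomp g (x : ideal_module I) : Prop := hpoly g (val x).

Definition qhcomp g (x : {ideal_quot I}) : Prop :=
  exists2 p, hpoly g p & x = \pi_{ideal_quot I} p.

Fact ihcomp_span x : exists (s : seq {ffun 'I_n -> int}) y,
  (forall g, ihcomp g (y g)) /\ x = \sum_(g <- s) y g.
Proof.
have [|y hy] := @choice _ _ (fun g (y : ideal_module I) =>
    (forall m, mdegz m = g -> m \in msupp (val x) ->
      val y = (val x)@_m *: 'X_[m]) /\ ihcomp g y).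
  move=> g.
  have [[m [mg mx]]|nm] := pselect (exists m, mdegz m = g /\ m \in msupp (val x)).
    have mI : (val x)@_m *: 'X_[m] \in (I : {pred S}).
      by rewrite -mul_mpolyC idealMr ?(mideal_msupp (imvalP x)).
    exists (IdealModule mI); split=> [m'|]; last by rewrite -mg; apply: hpoly_mono.
    by rewrite -mg => /mdegz_inj ->.
  exists 0; split=> [m mg mx|]; last exact: hpoly0.
  by case: nm; exists m.
exists (map mdegz (msupp (val x))), y; split=> [g|]; first by have [] := hy g.
apply: val_inj; rewrite raddf_sum big_map /= {1}[imval x]mpolyE.
by apply: eq_big_seq => m mx; rewrite ((hy _).1 m).
Qed.

Fact ihcomp_indep (s : seq {ffun 'I_n -> int}) y :
  uniq s -> (forall g, ihcomp g (y g)) -> \sum_(g <- s) y g = 0 ->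
  {in s, forall g, y g = 0}.
Proof.
move=> us hy sy g gs; apply: val_inj; apply/eqP; rewrite -msupp_eq0 -[_ == _]negbK.
apply/negP => /eqP; case E: (msupp _) => [|m t] // _.
have : m \in msupp (val (y g)) by rewrite E mem_head.
move=> /(hpoly_coeff (p := fun g => val (y g)) us hy gs).
by rewrite -raddf_sum /= sy msupp0.
Qed.

Fact ihcomp0 g : ihcomp g 0.
Proof. exact: hpoly0. Qed.

Fact ihcomp_lin g (c : K) x y :
  ihcomp g x -> ihcomp g y -> ihcomp g (c%:MP *: x + y).
Proof. exact: hpoly_lin. Qed.

Fact ihcompX m g x : ihcomp g x -> ihcomp (mdegz m + g) ('X_[m] *: x).
Proof. exact: hpolyX. Qed.

Definition ideal_grading : zgrading (ideal_module I) :=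
  ZGrading ihcomp0 ihcomp_lin ihcompX ihcomp_span ihcomp_indep.

Fact qhcomp0 g : qhcomp g 0.
Proof. by exists 0; [exact: hpoly0 | rewrite rmorph0]. Qed.

Fact qhcomp_lin g (c : K) x y :
  qhcomp g x -> qhcomp g y -> qhcomp g (c%:MP *: x + y).
Proof.
move=> [p hp ->] [q hq ->]; exists (c%:MP * p + q); first exact: hpoly_lin.
by rewrite rmorphD rmorphM.
Qed.

Fact qhcompX m g x : qhcomp g x -> qhcomp (mdegz m + g) ('X_[m] *: x).
Proof.
by move=> [p hp ->]; exists ('X_[m] * p); [exact: hpolyX | rewrite rmorphM].
Qed.

Fact qhcomp_span x : exists (s : seq {ffun 'I_n -> int}) y,
  (forall g, qhcomp g (y g)) /\ x = \sum_(g <- s) y g.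
Proof.
have [|y hy] := @choice _ _ (fun g (y : S) =>
    (forall m, mdegz m = g -> y = (repr x)@_m *: 'X_[m]) /\ hpoly g y).
  move=> g.
  have [[m <-]|nm] := pselect (exists m, mdegz m = g).
    exists ((repr x)@_m *: 'X_[m]); split; last exact: hpoly_mono.
    by move=> m' /mdegz_inj ->.
  exists 0; split=> [m mg|]; last exact: hpoly0.
  by case: nm; exists m.
exists (map mdegz (msupp (repr x))), (fun g => \pi_{ideal_quot I} (y g)).
split=> [g|]; first by exists (y g); first by have [] := hy g.
rewrite -{1}[x]reprK {1}[repr x]mpolyE rmorph_sum [RHS]big_map.
by apply: eq_bigr => m _; rewrite ((hy _).1 m).
Qed.

Fact qhcomp_indep (s : seq {ffun 'I_n -> int}) y :
  uniq s -> (forall g, qhcomp g (y g)) -> \sum_(g <- s) y g = 0 ->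
  {in s, forall g, y g = 0}.
Proof.
move=> us hy sy g gs.
have [|p hp] := @choice _ _ (fun g q => hpoly g q /\ y g = \pi_{ideal_quot I} q).
  by move=> h; have [q ? ?] := hy h; exists q.
have pI : \sum_(h <- s) p h \in (I : {pred S}).
  rewrite -[X in X \in _]subr0 Quotient.idealrBE rmorph0 -[X in _ == X]sy rmorph_sum.
  by apply/eqP; apply: eq_bigr => h _; have [] := hp h.
rewrite (hp g).2; apply/eqP; rewrite -(rmorph0 \pi_{ideal_quot I}).
rewrite -Quotient.idealrBE subr0.
apply: mideal_of_msupp => m mg; apply: (mideal_msupp pI).
by apply: hpoly_coeff mg => // h; have [] := hp h.
Qed.

Definition quot_grading : zgrading {ideal_quot I} :=
  ZGrading qhcomp0 qhcomp_lin qhcompX qhcomp_span qhcomp_indep.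

Definition minimal_generator (m : 'X_{1..n}) : Prop :=
  'X_[m] \in (I : {pred S}) /\
  forall m', 'X_[m'] \in (I : {pred S}) -> (m' <= m)%MM -> m' = m.

(* The empty subset has lcm 1, that is, exponent 0. *)
Definition in_lcm_lattice (m : 'X_{1..n}) : Prop :=
  exists A : seq 'X_{1..n},
    (forall a, a \in A -> minimal_generator a) /\ m = \big[@mlcm n/0%MM]_(a <- A) a.

Definition lcm_lattice_iso d (L : finTBLatticeType d) : Prop :=
  exists f : L -> 'X_{1..n},
    (forall x y, (f x <= f y)%MM = (x <= y)%O) /\
    forall m, in_lcm_lattice m <-> exists x, f x = m.

End OfIdeal.
End Graded.

Section Lattices.
Variables (d : Order.disp_t) (L : finTBLatticeType d).

Definition is_atom (a : L) : bool :=
  (a != \bot)%O && [forall x : L, (x < a)%O ==> (x == \bot)%O].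

Definition num_atoms : nat := #|[pred a : L | is_atom a]|.

Definition atomistic : Prop :=
  forall x : L, exists A : {set L},
    (forall a, a \in A -> is_atom a) /\ x = (\join_(a in A) a)%O.

End Lattices.

Definition lattice_iso d (L : finTBLatticeType d)
    d' (L' : finTBLatticeType d') : Prop :=
  exists f : L -> L', bijective f /\ forall x y, (f x <= f y)%O = (x <= y)%O.

(* Such a map automatically preserves the empty join. *)
Definition surjective_join_map d (L : finTBLatticeType d)
    d' (L' : finTBLatticeType d') (f : L -> L') : Prop :=
  (forall x y, f (Order.join x y) = Order.join (f x) (f y)) /\
  forall y, exists x, f x = y.

(* The invariants of a lattice L are those of any monomial ideal I, in any
   number n of variables, with lcm lattice isomorphic to L; [xget] selects this
   common value. The default 0 is not used when L is atomistic with at least one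
   atom: then such an I exists, and S / I has finite projective dimension. *)
Section LatticeInvariants.
Variables (K : fieldType) (d : Order.disp_t) (L : finTBLatticeType d).

Definition pdimQ : nat := xget 0%N [set p | exists n (I : monomialIdeal K n),
  lcm_lattice_iso I L /\ is_pdim {ideal_quot I} p]%classic.

Definition spdimQ : nat := xget 0%N [set p | exists n (I : monomialIdeal K n),
  lcm_lattice_iso I L /\ p = spdim (quot_grading I)]%classic.

Definition spdimI : nat := xget 0%N [set p | exists n (I : monomialIdeal K n),
  lcm_lattice_iso I L /\ p = spdim (ideal_grading I)]%classic.

End LatticeInvariants.

Definition maximal_lattice (K : fieldType) d (L : finTBLatticeType d) : Prop :=
  forall d' (L' : finTBLatticeType d'),
    atomistic L' -> ~ lattice_iso L' L -> num_atoms L' = num_atoms L ->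
    (exists f : L' -> L, surjective_join_map f) ->
    (pdimQ K L < pdimQ K L')%N.

(* Main.v *)
(* Let m_1, ..., m_k be the minimal generators of I, corresponding to the atoms
   of L, and call a generator b redundant over a set B if m_b divides the lcm
   of B, i.e. if b <= join B in L.

   The Taylor complex is a free resolution of S / I. If S / I has a projective
   resolution of length k - 2, comparison with the Taylor complex splits the
   latter above degree k - 2, so modulo the variables it is exact in degree
   k - 1. Testing this on explicit cycles shows: the set V of the generators
   redundant over all the others is nonempty; it is connected by the edges
   {u, v} such that u or v is redundant over the complement of {u, v}; and each
   generator outside V is joined to V by such an edge. This condition only
   depends on L, so it passes to every ideal with lcm lattice L.

   Under it, S / I is split repeatedly along a variable x into the parts of
   x-degree 0 and > 0; as one variable is lost, it is enough that the first part
   has Stanley projective dimension at most k - 3. This holds if x divides at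
   least 3 generators, as at most k - 3 are then left. If all variables divide at
   most 2, choose x whose two generators p, q are closest in the graph: a vertex c
   of V between p and q is then redundant over the generators other than p, q, c,
   and this lowers the bound k - 2 for the first part by one. If all variables
   divide at most one generator, those in V are 1 and I = S.

   For the ideal the bound k - 1 holds for any k generators, by filtering I. *)
From HB Require Import structures.
Require Import Defs.
From mathcomp Require Import all_boot all_order all_algebra.
From mathcomp Require Import ring_quotient generic_quotient.
From mathcomp Require Import boolp.
From mathcomp Require classical_sets.
From mathcomp Require Import mpoly.
From mathcomp Require Import zify.

Set Implicit Arguments.
Unset Strict Implicit.
Unset Printing Implicit Defensive.

Import Order.TTheory GRing.Theory.

(** * Splitting the complement of a monomial ideal into cells *)

Section MonomialCovers.
Variables (n : nat) (I : finType).
Implicit Types (u : 'X_{1..n}) (x y : 'I_n) (W Z : {set 'I_n}) (A : {set I})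
  (e : I -> 'X_{1..n}) (c : 'X_{1..n} * {set 'I_n}) (d : nat).

(* A pair (m, Z) stands for the set of the monomials of X^m K[Z]. *)
Definition in_cell u c : bool :=
  [forall i, if i \in c.2 then c.1 i <= u i else u i == c.1 i].

Definition avoids W A e u : bool :=
  [forall i, (u i != 0) ==> (i \in W)] &&
  [forall a in A, [exists i in W, u i < e a i]].

(* The monomials in the variables W outside the ideal (X^(e a) : a in A) are the
   disjoint union of finitely many cells X^m K[Z] with #|Z| >= #|W| - d. *)
Definition coverable W A e d : Prop :=
  exists s : seq ('X_{1..n} * {set 'I_n}),
    (forall c, c \in s -> #|W| <= #|c.2| + d) /\
    forall u, count (in_cell u) s = avoids W A e u.

(* Truncated subtraction: the ideal of [lower x e] is the colon ideal by X_x. *)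
Definition lower x e : I -> 'X_{1..n} := fun a => (e a - U_(x))%MM.

Definition divisors_at A e x : {set I} := [set a in A | e a x > 0].

Definition dominated W e (b : I) (B : {set I}) : Prop :=
  forall x, x \in W -> e b x > 0 -> exists2 a, a \in B & e b x <= e a x.

Lemma lowerE x e a i : lower x e a i = e a i - (i == x).
Proof. by rewrite /lower mnmBE mnm1E eq_sym. Qed.

Lemma dominated_lower W e x b B : dominated W e b B -> dominated W (lower x e) b B.
Proof.
move=> h y yW; rewrite lowerE => eb.
have [|a aB ha] := h y yW; first by lia.
by exists a => //; rewrite !lowerE; lia.
Qed.

Lemma avoids_eq0 W A e u x : x \in W -> u x = 0 ->
  avoids W A e u = avoids (W :\ x) (A :\: divisors_at A e x) e u.
Proof.
move=> xW ux; rewrite /avoids; congr (_ && _).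
  apply: eq_forallb => i; rewrite !inE; case: (eqVneq i x) => // ->.
  by rewrite ux eqxx.
apply/forall_inP/forall_inP => h a.
  rewrite !inE => /andP[na aA]; move: na; rewrite aA /= -leqNgt leqn0 => /eqP ax.
  have /exists_inP[i iW hi] := h a aA; apply/exists_inP; exists i => //.
  by rewrite !inE iW andbT; apply/eqP => ix; move: hi; rewrite ix ax ltn0.
move=> aA; have [ax|ax] := posnP (e a x).
  have /h/exists_inP[i] : a \in A :\: divisors_at A e x.
    by rewrite !inE aA ax.
  by rewrite !inE => /andP[_ iW] hi; apply/exists_inP; exists i.
by apply/exists_inP; exists x => //; rewrite ux.
Qed.

Lemma avoids_gt0 W A e u x : x \in W -> u x > 0 ->
  avoids W A e u = avoids W A (lower x e) (u - U_(x))%MM.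
Proof.
move=> xW ux; rewrite /avoids; congr (_ && _).
  apply: eq_forallb => i; rewrite mnmBE mnm1E; case: (eqVneq x i) => [<-|_].
    by rewrite xW !implybT.
  by rewrite subn0.
apply: eq_forallb => a; congr (_ ==> _); apply: eq_existsb => i; congr (_ && _).
rewrite lowerE mnmBE mnm1E eq_sym; case: (eqVneq i x) => [->|_]; last by lia.
by rewrite /=; lia.
Qed.

Lemma avoids_out W A e u x : x \notin W -> u x > 0 -> avoids W A e u = false.
Proof.
move=> xW ux; apply/negbTE/negP => /andP[/forallP/(_ x)].
by rewrite -lt0n ux (negbTE xW).
Qed.

(** The monomials are split by whether [x] divides them. Cells for the part free of [x] lie in
    [W :\ x], so [d] there amounts to [d.+1] over [W]. Cells for the other part are those of the
    colon ideal, shifted by [x]. *)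
Lemma coverable_step W A e d x : x \in W ->
  coverable (W :\ x) (A :\: divisors_at A e x) e d ->
  coverable W A (lower x e) d.+1 -> coverable W A e d.+1.
Proof.
move=> xW [s0 [d0 h0]] [s1 [d1 h1]].
exists (s0 ++ [seq ((c.1 + U_(x))%MM, c.2) | c <- s1]); split.
  move=> c; rewrite mem_cat => /orP[/d0|/mapP[c' /d1 h ->]] //=.
  by rewrite (cardsD1 x W) xW add1n => /leq_ltn_trans/(_ (ltnSn _)); rewrite addnS; apply.
move=> u; rewrite count_cat count_map.
have [ux|ux] := posnP (u x).
  rewrite h0 -(avoids_eq0 _ _ xW ux) -[RHS]addn0; congr addn.
  apply/eqP; rewrite eqn0Ngt -has_count; apply/hasPn => c _ /=.
  apply/negP => /forallP/(_ x) /=; rewrite ux mnmDE mnm1E eqxx.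
  by case: ifP => _; lia.
rewrite h0 (@avoids_out _ _ _ _ x) ?inE ?eqxx // add0n (avoids_gt0 _ _ xW ux) -h1.
apply: eq_count => c /=; apply: eq_forallb => i.
rewrite mnmDE mnmBE mnm1E; case: (eqVneq x i) => [<-|_]; last by rewrite addn0 subn0.
by case: ifP => _; lia.
Qed.

Lemma coverable_trivial W A e d a : a \in A -> (forall x, x \in W -> e a x = 0) ->
  coverable W A e d.
Proof.
move=> aA ea0; exists [::]; split=> // u /=; apply/esym/eqP; rewrite eqb0.
apply/negP => /andP[_ /forall_inP/(_ a aA)/exists_inP[i /ea0->]].
by rewrite ltn0.
Qed.

Lemma coverable_set0 W e d : coverable W set0 e d.
Proof.
exists [:: (0%MM, W)]; split=> [c|u]; first by rewrite inE => /eqP->; rewrite leq_addr.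
rewrite /= addn0 /avoids; congr nat_of_bool.
rewrite [X in _ && X](_ : _ = true) ?andbT; last by apply/forall_inP => a; rewrite inE.
by apply: eq_forallb => i /=; rewrite mnm0E; case: (i \in W); rewrite ?implybT // implybF negbK.
Qed.

(** The total degree of the generators is the induction measure for the repeated splitting. *)
Lemma lower_measure x e a : e a x > 0 ->
  \sum_b mdeg (lower x e b) < \sum_b mdeg (e b).
Proof.
move=> ax; have h b : mdeg (lower x e b) <= mdeg (e b) by exact: mdegB.
rewrite (bigD1 a) //= [X in _ < X](bigD1 a) //= -addSn leq_add ?leq_sum //.
rewrite /lower -[X in _ < mdeg X](@submK _ U_(x)) ?mdegD ?mdeg1 ?addn1 //.
by rewrite lep1mP -lt0n.
Qed.

(** Splitting along a variable of some generator leaves fewer generators in the part free of it and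
    a smaller total degree in the other. *)
Lemma coverable_card W A e d : #|A| <= d -> coverable W A e d.
Proof.
elim: d W A e => [|d IHd] W A e.
  by rewrite leqn0 cards_eq0 => /eqP->; apply: coverable_set0.
have [m] := ubnP (\sum_b mdeg (e b)); elim: m e => // m IHm e lem leA.
have [->|[a aA]] := set_0Vmem A; first exact: coverable_set0.
have [ea0|/forall_inPn[x xW ax]] := boolP [forall x in W, e a x == 0].
  by apply: (coverable_trivial _ aA) => x xW; apply/eqP; have /forall_inP/(_ x xW) := ea0.
move: ax; rewrite -lt0n => ax; apply: (coverable_step xW).
  apply: IHd; rewrite -ltnS; apply: leq_trans leA; apply: proper_card.
  apply/properP; split; first exact: subsetDl.
  by exists a => //; rewrite !inE aA ax.
by apply: IHm => //; apply: leq_trans (lower_measure ax) _; rewrite -ltnS.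
Qed.

(** Every variable of [c] also divides another generator, so the part free of it loses two
    generators. This gains one over [coverable_card]. *)
Lemma coverable_dominated W A e d (c : I) : c \in A -> dominated W e c (A :\ c) ->
  #|A| <= d.+1 -> coverable W A e d.
Proof.
move=> cA; have [m] := ubnP (\sum_b mdeg (e b)); elim: m e => // m IHm e lem dc leA.
have [c0|/forall_inPn[x xW cx]] := boolP [forall x in W, e c x == 0].
  by apply: (coverable_trivial _ cA) => x xW; apply/eqP; have /forall_inP/(_ x xW) := c0.
move: cx; rewrite -lt0n => cx; have [a /[!inE] /andP[ac aA] ax] := dc x xW cx.
have sA : [set a; c] \subset A by rewrite subUset !sub1set aA.
have leAD : #|A :\: divisors_at A e x| + 2 <= #|A|.
  have -> : 2 = #|[set a; c]| by rewrite cards2 ac.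
  rewrite -(cardsID (divisors_at A e x) A) addnC leq_add2r.
  apply: subset_leq_card; apply/subsetP => b hb; rewrite inE (subsetP sA) //=.
  by move: hb; rewrite !inE => /orP[]/eqP->; rewrite ?aA ?cA ?cx // (leq_trans cx).
case: d leA IHm => [|d] leA IHm; first by lia.
apply: (coverable_step xW); first by apply: coverable_card; lia.
apply: IHm => //; last exact: dominated_lower.
by apply: leq_trans (lower_measure cx) _; rewrite -ltnS.
Qed.

End MonomialCovers.

(** * A graph condition that lowers the bound to two below the number of generators *)

Section TreeCondition.
Variables (I : finType) (V : {set I}) (adj : rel I).

(* Walks all of whose interior vertices are in V. *)
Inductive linked : I -> I -> Prop :=
| linked1 p q : adj p q -> linked p q
| linkedS p c q : adj p c -> c \in V -> linked c q -> linked p q.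

Lemma linked_trans p c q : c \in V -> linked p c -> linked c q -> linked p q.
Proof.
move=> cV pc; elim: pc cV => [a b ab bV bq|a b x ab bV _ IH xV xq].
  exact: linkedS bq.
by apply: linkedS bV _ => //; apply: IH.
Qed.

(** Let [c] be the second vertex of the walk, not live with the first one by adjacency. Either it is
    not live with the end, and is the required vertex, or the shorter walk from [c] to the end is
    used. *)
Lemma linked_between (live : rel I) : ssrbool.symmetric live ->
  (forall p q, adj p q -> ~~ live p q) ->
  forall p q, linked p q -> live p q ->
  exists p' q' c, [/\ live p' q', c \in V, ~~ live p' c & ~~ live c q'].
Proof.
move=> sl al p q; elim=> [a b /al/negbTE-> //|a c b ac cV cb IH ab].
have [/IH //|ncb] := boolP (live c b).
by exists a, b, c; split=> //; apply: al.
Qed.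

Variable n : nat.
Implicit Types (W : {set 'I_n}) (e : I -> 'X_{1..n}) (d : nat).

(** The hypotheses survive [lower], so in each splitting the part divisible by the variable is
    covered by induction on the total degree, and only the part free of it has to be bounded. *)
Lemma coverable_tree W e d v0 : v0 \in V ->
  (forall v, v \in V -> dominated W e v (~: [set v])) ->
  (forall p q, adj p q -> dominated W e p (~: [set p; q]) \/
                          dominated W e q (~: [set p; q])) ->
  (forall p q, p != q -> linked p q) ->
  #|I| <= d.+2 -> coverable W setT e d.
Proof.
move=> v0V domV domE link leI.
have [m] := ubnP (\sum_b mdeg (e b)); elim: m e domV domE => // m IHm e domV domE lem.
pose D x := divisors_at setT e x.
have inD a x : (a \in D x) = (e a x > 0) by rewrite !inE.
have cardD x : #|setT :\: D x| + #|D x| = #|I|.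
  by rewrite -cardsT -(cardsID (D x) setT) setTI addnC.
have IH x : x \in W -> D x != set0 -> coverable W setT (lower x e) d.
  move=> xW /set0Pn[a /[!inD] ax]; apply: IHm.
  - by move=> v /domV; apply: dominated_lower.
  - by move=> p q /domE[]; [left|right]; apply: dominated_lower.
  - by apply: leq_trans (lower_measure ax) _; rewrite -ltnS.
have [/exists_inP[x xW leD]|/exists_inPn noD3] := boolP [exists x in W, 2 < #|D x|].
  have D0 : D x != set0 by rewrite -card_gt0; lia.
  case: d leI IH {IHm} => [|d] leI IH; first by have := cardD x; lia.
  apply: (coverable_step xW); last exact: IH.
  by apply: coverable_card; rewrite -/(D x); have := cardD x; lia.
pose live p q := (p != q) && [exists x in W, D x == [set p; q]].
have slive : ssrbool.symmetric live.
  by move=> p q; rewrite /live eq_sym; congr andb; apply: eq_existsb => x; rewrite setUC.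
have adjN p q : adj p q -> ~~ live p q.
  move=> pq; apply/negP => /andP[_ /exists_inP[x xW /eqP Dx]].
  (* A generator dominating [b] at [x] would be a third one divisible by [x]. *)
  have hin b : b \in [set p; q] -> ~ dominated W e b (~: [set p; q]).
    rewrite -{1}Dx inD => bx /(_ x xW bx)[a ha ea].
    by move: ha; rewrite inE -Dx inD; lia.
  by have [] := domE p q pq; apply: hin; rewrite !inE eqxx ?orbT.
have [/existsP[p /existsP[q pq]]|nolive] := boolP [exists p, exists q, live p q].
  have /link lpq : p != q by have /andP[] := pq.
  have [{}p [{}q [c [{lpq}pq cV pc cq]]]] := linked_between slive adjN lpq pq.
  have /andP[npq /exists_inP[x xW /eqP Dx]] := pq.
  have D0 : D x != set0 by rewrite Dx; apply/set0Pn; exists p; rewrite !inE eqxx.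
  have cardDx : #|D x| = 2 by rewrite Dx cards2 npq.
  have cp : c != p by apply/negP => /eqP cp; move: cq; rewrite cp pq.
  have ncq : c != q by apply/negP => /eqP cq'; move: pc; rewrite cq' pq.
  have cA : c \in setT :\: D x by rewrite Dx !inE (negbTE cp) (negbTE ncq).
  have : 0 < #|setT :\: D x| by rewrite card_gt0; apply/set0Pn; exists c.
  case: d leI IH {IHm} => [|d] leI IH posA.
    by have := cardD x; rewrite cardDx; move: leI posA; clear; lia.
  apply: (coverable_step xW); last exact: IH.
  (* A variable [y] of [c] divides exactly one other generator [a]. As [c] is live with neither [p]
     nor [q], [a] is neither of them and survives the removal of [D x]. *)
  apply: (coverable_dominated cA); last first.
    by rewrite -/(D x); have := cardD x; rewrite cardDx; move: leI; clear; lia.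
  move=> y /[!inE] /andP[yx yW] cy; have [a /[!inE] ac ay] := domV c cV y yW cy.
  exists a => //; rewrite in_setD1 ac in_setD in_setT andbT -/(D x) Dx.
  have Dy : D y = [set c; a].
    apply/esym/eqP; rewrite eqEcard subUset !sub1set !inD cy (leq_trans cy ay) /=.
    by rewrite cards2 eq_sym ac leqNgt noD3.
  rewrite !inE; apply/norP; split; apply/negP => /eqP ea.
    by move/negP: pc; apply; rewrite slive /live cp; apply/exists_inP; exists y; rewrite ?Dy ?ea.
  by move/negP: cq; apply; rewrite /live ncq; apply/exists_inP; exists y; rewrite ?Dy ?ea.
(* No variable of [W] divides [v0]: it would divide a second generator, and the two would be
   live. *)
apply: (@coverable_trivial _ _ _ _ _ _ v0) => // x xW; apply/eqP; rewrite eqn0Ngt.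
apply/negP => vx; have [a /[!inE] av ax] := domV v0 v0V x xW vx.
move/existsP: nolive; apply; exists v0; apply/existsP; exists a.
rewrite /live eq_sym av; apply/exists_inP; exists x => //.
rewrite eq_sym eqEcard subUset !sub1set !inD vx (leq_trans vx ax) /=.
by rewrite cards2 eq_sym av leqNgt noD3.
Qed.

End TreeCondition.

(** * Stanley decompositions from cells *)

Local Open Scope ring_scope.
Local Open Scope quotient_scope.

Section PolyIn.
Variables (K : fieldType) (n : nat) (Z : {set 'I_n}).

Lemma polyinB (p q : {mpoly K[n]}) : polyin Z p -> polyin Z q -> polyin Z (p - q).
Proof.
by move=> hp hq m /msuppB_le; rewrite mem_cat => /orP[/hp|/hq].
Qed.

Lemma polyin0 : polyin Z (0 : {mpoly K[n]}).
Proof. by move=> m; rewrite msupp0. Qed.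

Lemma in_cell_msupp (p : {mpoly K[n]}) m u :
  polyin Z p -> u \in msupp (p * 'X_[m]) -> in_cell u (m, Z).
Proof.
move=> hp; rewrite (perm_mem (msuppMX p m)) => /mapP[w /hp hw ->].
apply/forallP => i /=; rewrite mnmDE; case: ifPn => [_|iZ]; first exact: leq_addr.
have [->|/hw] := eqVneq (w i) 0%N; first by rewrite addn0.
by rewrite (negbTE iZ).
Qed.

End PolyIn.

Section StanleyBasis.
Variables (K : fieldType) (n : nat) (M : lmodType {mpoly K[n]}) (G : zgrading M).
Variables (r : nat) (lam : 'I_r -> M) (Z : 'I_r -> {set 'I_n}).

Lemma hcomp_sum g (v : 'I_r -> M) :
  (forall i, hcomp G g (v i)) -> hcomp G g (\sum_i v i).
Proof.
move=> h; apply: (big_ind (hcomp G g)) => [|x y hx hy|//]; first exact: hcomp0.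
by rewrite -[x]scale1r -mpolyC1; apply: hcomp_lin.
Qed.

(** The isomorphism adds up the entries. Freeness of one space is independence for a family
    supported at one index. *)
Lemma stanley_decomposition_of_basis :
  (forall i, homogeneous G (lam i)) ->
  (forall p : 'I_r -> {mpoly K[n]}, (forall i, polyin (Z i) (p i)) ->
     \sum_i p i *: lam i = 0 -> forall i, p i = 0) ->
  (forall x, exists2 p : 'I_r -> {mpoly K[n]}, forall i, polyin (Z i) (p i) &
     x = \sum_i p i *: lam i) ->
  is_stanley_decomposition G lam Z.
Proof.
move=> hom indep gen; split=> [i|].
  split=> // p hp p0; have := indep (fun j => if j == i then p else 0) _ _ i.
  rewrite eqxx; apply=> [j|]; first by case: eqP => [->|_] //; exact: polyin0.
  rewrite (bigD1 i) //= eqxx p0 big1 ?addr0 // => j /negbTE->.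
  by rewrite scale0r.
exists (fun v => \sum_i v i); split=> [c u v _ _|g v _ h|u v hu hv uv|x].
- by rewrite scaler_sumr -big_split; apply: eq_bigr => i _; rewrite !ffunE.
- exact: hcomp_sum.
- have [p hp] := choice (fun i => let: ex_intro2 p hp e := hu i in
    ex_intro (fun p => polyin (Z i) p /\ u i = p *: lam i) p (conj hp e)).
  have [q hq] := choice (fun i => let: ex_intro2 p hp e := hv i in
    ex_intro (fun p => polyin (Z i) p /\ v i = p *: lam i) p (conj hp e)).
  have pq0 : forall i, p i - q i = 0.
    apply: indep => [i|]; first by apply: polyinB; [case: (hp i)|case: (hq i)].
    have -> : \sum_i (p i - q i) *: lam i = \sum_i u i - \sum_i v i.
      rewrite -sumrB; apply: eq_bigr => i _; rewrite scalerBl.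
      by case: (hp i) => _ ->; case: (hq i) => _ ->.
    by rewrite uv subrr.
  apply/ffunP => i; case: (hp i) => _ ->; case: (hq i) => _ ->.
  by have /eqP := pq0 i; rewrite subr_eq0 => /eqP->.
- have [p hp ->] := gen x; exists [ffun i => p i *: lam i].
    by move=> i; rewrite ffunE; exists (p i).
  by apply: eq_bigr => i _; rewrite ffunE.
Qed.

Lemma sdepth_ge s : is_stanley_decomposition G lam Z -> (0 < r)%N ->
  (forall i, (s <= #|Z i|)%N) -> (s <= sdepth G)%N.
Proof.
move=> dec r0 hs; pose i0 := [arg min_(i < Ordinal r0) #|Z i|]%N.
have mi0 i : (#|Z i0| <= #|Z i|)%N by rewrite /i0; case: arg_minnP => // j _; apply.
have lei : (#|Z i0| < n.+1)%N by rewrite ltnS -[X in (_ <= X)%N]card_ord max_card.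
apply: leq_trans (hs i0) _.
apply: (@leq_bigmax_cond _ _ (fun i : 'I_n.+1 => i : nat) (Ordinal lei)).
by apply/asboolP; exists r, lam, Z; split=> //; exists i0.
Qed.

End StanleyBasis.

Section CoverDecomposition.
Variables (K : fieldType) (n : nat) (C : pred 'X_{1..n}).
Variable s : seq ('X_{1..n} * {set 'I_n}).
Hypothesis cover : forall u, count (in_cell u) s = C u.
Local Notation S := {mpoly K[n]}.
Let c (i : 'I_(size s)) := tnth (in_tuple s) i.

Lemma cell_sum u : (\sum_i (in_cell u (c i)) = C u)%N.
Proof.
rewrite -cover -sum1_count [RHS]big_mkcond [RHS]big_tnth.
by apply: eq_bigr => i _; case: in_cell.
Qed.

Lemma cell_sub i u : in_cell u (c i) -> C u.
Proof. by move=> ui; have := cell_sum u; rewrite (bigD1 i) //= ui; case: (C u). Qed.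

Lemma cell_uniq u i j : in_cell u (c i) -> in_cell u (c j) -> i = j.
Proof.
move=> ui uj; apply/eqP/negP => ij; have := cell_sum u.
rewrite (bigD1 i) //= ui (bigD1 j) /= ?uj; last by rewrite eq_sym; apply/negP.
by case: (C u).
Qed.

Lemma cell_corner i : C (c i).1.
Proof.
by apply: (@cell_sub i); apply/forallP => j; case: ifP.
Qed.

(** Cells are disjoint, so the coefficient at a monomial of cell [i] only involves [p i]. Vanishing
    is assumed on [C] alone because in the quotient the sum is zero only modulo the ideal. *)
Lemma cover_indep (p : 'I_(size s) -> S) : (forall i, polyin (c i).2 (p i)) ->
  (forall u, C u -> (\sum_i p i * 'X_[(c i).1])@_u = 0) -> forall i, p i = 0.
Proof.
move=> hp h0 i; apply/mpolyP => w; rewrite mcoeff0; apply/eqP/negPn/negP => nw.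
pose u := ((c i).1 + w)%MM.
have ui : in_cell u (c i).
  rewrite [c i]surjective_pairing; apply: (in_cell_msupp (hp i)).
  by rewrite mcoeff_msupp mcoeffMX.
have := h0 _ (cell_sub ui); rewrite raddf_sum (bigD1 i) //= mcoeffMX big1 ?addr0; first exact/eqP.
move=> j ij; apply: memN_msupp_eq0; apply: contra ij => uj; apply/eqP.
apply: (@cell_uniq u) => //; rewrite [c j]surjective_pairing.
exact: (in_cell_msupp (hp j)).
Qed.

Lemma cover_gen (q : S) : (forall u, u \in msupp q -> C u) ->
  exists2 p : 'I_(size s) -> S, forall i, polyin (c i).2 (p i) &
    q = \sum_i p i * 'X_[(c i).1].
Proof.
move=> hq; pose p i : S := \sum_(u <- msupp q | in_cell u (c i)) q@_u *: 'X_[u - (c i).1].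
have lec i u : in_cell u (c i) -> ((c i).1 <= u)%MM.
  by move=> /forallP h; apply/mnm_lepP => j; have := h j; case: ifP => // _ /eqP->.
exists p => [i m /msupp_sum_le/flatten_mapP[u]|].
  rewrite mem_filter => /andP[ui _] /msuppZ_le; rewrite msuppX inE => /eqP-> j.
  rewrite mnmBE subn_eq0 -ltnNge => lt; apply/negPn/negP => jZ.
  by have /forallP/(_ j) := ui; rewrite (negbTE jZ) => /eqP uj; rewrite uj ltnn in lt.
rewrite {1}[q]mpolyE.
under [RHS]eq_bigr => i _.
  rewrite mulr_suml (eq_bigr (fun u => q@_u *: 'X_[u])); last first.
    by move=> u /lec ui; rewrite -scalerAl -mpolyXD submK.
  rewrite big_mkcond /=.
  over.
rewrite exchange_big /= big_seq [RHS]big_seq; apply: eq_bigr => u /hq Cu.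
have := cell_sum u; rewrite Cu => cu.
rewrite -[LHS]mulr1n -[1%N]/(nat_of_bool true) -cu -sumrMnr.
by apply: eq_bigr => i _; case: in_cell.
Qed.

End CoverDecomposition.

Section Modules.
Variables (K : fieldType) (n : nat) (J : monomialIdeal K n).
Local Notation S := {mpoly K[n]}.

Lemma quot_eq0P (p : S) : (\pi_{ideal_quot J} p = 0) <-> p \in (J : {pred S}).
Proof.
rewrite -[X in X \in _]subr0 Quotient.idealrBE rmorph0.
by split=> [->|/eqP].
Qed.

Lemma quot_sdepth_ge (s : seq ('X_{1..n} * {set 'I_n})) t :
  (forall u, count (in_cell u) s = ('X_[u] \notin (J : {pred S}))) ->
  (forall c, c \in s -> (t <= #|c.2|)%N) ->
  (t <= sdepth (quot_grading J))%N.
Proof.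
move=> cov ht; pose c := tnth (in_tuple s).
apply: (@sdepth_ge _ _ _ _ _ (fun i => \pi_{ideal_quot J} 'X_[(c i).1]) (fun i => (c i).2)).
- apply: stanley_decomposition_of_basis => [i|p hp p0|x].
  + exists (mdegz (c i).1), 'X_[(c i).1] => // m.
    by rewrite msuppX inE => /eqP->.
  + apply: (cover_indep cov hp) => u uJ; apply: memN_msupp_eq0; apply: contra uJ.
    apply: mideal_msupp; apply/quot_eq0P; rewrite -[RHS]p0 rmorph_sum /=.
    by apply: eq_bigr => i _; rewrite rmorphM.
  (* [q] keeps the monomials of the representative outside [J]; the others vanish in the
     quotient. *)
  + pose q : S := \sum_(u <- msupp (repr x) | 'X_[u] \notin (J : {pred S})) (repr x)@_u *: 'X_[u].
    have [|p hp qp] := @cover_gen K _ _ _ cov q.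
      move=> u /msupp_sum_le/flatten_mapP[v]; rewrite mem_filter => /andP[vJ _] /msuppZ_le.
      by rewrite msuppX inE => /eqP->.
    exists p => //; transitivity (\pi_{ideal_quot J} q).
      rewrite -{1}[x]reprK; apply/eqP; rewrite -Quotient.idealrBE.
      rewrite {1}[repr x]mpolyE (bigID (fun u => 'X_[u] \in (J : {pred S}))) /= addrK.
      by apply: rpred_sum => u uJ; rewrite -mul_mpolyC idealMr.
    by rewrite qp rmorph_sum /=; apply: eq_bigr => i _; rewrite rmorphM.
(* At least one cell is needed for a depth; the proper ideal [J] misses 1, so there is one. *)
- have : ('X_[0%MM] \notin (J : {pred S})) by rewrite mpolyX0 idealr1.
  by move=> h; have := cov 0%MM; rewrite h; case: (s).
- by move=> i; apply: ht; apply: mem_tnth.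
Qed.

Lemma ideal_sdepth_ge (s : seq ('X_{1..n} * {set 'I_n})) t :
  (forall u, count (in_cell u) s = ('X_[u] \in (J : {pred S}))) ->
  (forall c, c \in s -> (t <= #|c.2|)%N) ->
  (t <= sdepth (ideal_grading J))%N.
Proof.
move=> cov ht; pose c := tnth (in_tuple s).
pose lam i := IdealModule (cell_corner cov i).
have valE (p : 'I_(size s) -> S) :
    imval (\sum_i p i *: lam i) = \sum_i p i * 'X_[(c i).1].
  by rewrite -[LHS]/(val (\sum_i p i *: lam i)) raddf_sum; apply: eq_bigr.
apply: (@sdepth_ge _ _ _ _ _ lam (fun i => (c i).2)).
- apply: stanley_decomposition_of_basis => [i|p hp p0|x].
  + exists (mdegz (c i).1) => m /=.
    by rewrite msuppX inE => /eqP->.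
  + apply: (cover_indep cov hp) => u uJ.
    by rewrite -/c -valE p0 mcoeff0.
  + have [|p hp qp] := @cover_gen K _ _ _ cov (imval x).
      by move=> u; apply: mideal_msupp; apply: imvalP.
    by exists p => //; apply: val_inj; rewrite /= valE.
- have [p pJ p0] := mideal_neq0 J.
  case E: (msupp p) => [|u v]; first by rewrite -msupp_eq0 E in p0.
  have : 'X_[u] \in (J : {pred S}) by apply: (mideal_msupp pJ); rewrite E mem_head.
  by move=> h; have := cov u; rewrite h; case: (s).
- by move=> i; apply: ht; apply: mem_tnth.
Qed.

End Modules.

(** * Projective resolutions *)

Lemma linear_pack (R : nzRingType) (U V : lmodType R) (f : U -> V) :
  linear f -> exists g : {linear U -> V}, g =1 f.
Proof.
move=> lf; pose fl := GRing.isLinear.Build R U V *:%R f lf.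
by exists (HB.pack f fl : {linear U -> V}).
Qed.

Section Pullback.
Variables (R : nzRingType) (P M N : lmodType R).
Variables (f : {linear M -> N}) (g : {linear P -> N}).

Definition pullback_pred : {pred (P * M)%type} := fun x => g x.1 == f x.2.

Fact pullback_submod_closed : submod_closed pullback_pred.
Proof.
split=> [|a x y]; rewrite /in_mem /= /pullback_pred /=; first by rewrite !linear0.
by move=> /eqP ex /eqP ey; rewrite !linearP ex ey.
Qed.

HB.instance Definition _ :=
  GRing.isSubmodClosed.Build R (P * M)%type pullback_pred pullback_submod_closed.

Record pullback := Pullback { pbval :> (P * M)%type; _ : pbval \in pullback_pred }.

HB.instance Definition _ := [isSub for pbval].
HB.instance Definition _ := [Choice of pullback by <:].
HB.instance Definition _ := [SubChoice_isSubLmodule of pullback by <:].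

(** [projective_module] lifts along surjections. The pullback of [f] along [g] projects onto [P]; a
    section of this projection, followed by the projection to [M], is the lift. *)
Lemma projective_lift : projective_module P ->
  (forall y, exists x, f x = g y) ->
  exists h : {linear P -> M}, forall y, f (h y) = g y.
Proof.
move=> projP surj.
have [p1 p1E] : exists p : {linear pullback -> P}, p =1 fun x => (val x).1.
  by apply: linear_pack => a x y; rewrite !linearP.
have [p2 p2E] : exists p : {linear pullback -> M}, p =1 fun x => (val x).2.
  by apply: linear_pack => a x y; rewrite !linearP.
have [y|h hE'] := projP _ _ p1 (idfun : {linear P -> P}).
  have [x xy] := surj y.
  have yx : (y, x) \in pullback_pred by rewrite /in_mem /= /pullback_pred /= xy.
  by exists (Pullback yx); rewrite p1E.
have hE y : p1 (h y) = y by exact: hE'.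
exists (p2 \o h : {linear P -> M}) => y /=; rewrite -[in RHS](hE y) /= p1E p2E.
by apply/esym/eqP; case: (h y).
Qed.

End Pullback.

Section Projectives.
Variable R : nzRingType.

Lemma projective_prod (P Q : lmodType R) :
  projective_module P -> projective_module Q -> projective_module (P * Q)%type.
Proof.
move=> projP projQ M N f g surj.
have [i1 i1E] : exists i : {linear P -> (P * Q)%type}, i =1 fun x => (x, 0).
  apply: linear_pack => a x y; congr pair.
  by rewrite /= scaler0 addr0.
have [i2 i2E] : exists i : {linear Q -> (P * Q)%type}, i =1 fun x => (0, x).
  apply: linear_pack => a x y; congr pair.
  by rewrite /= scaler0 addr0.
have [h1 h1E] := projP M N f (g \o i1) surj.
have [h2 h2E] := projQ M N f (g \o i2) surj.
have [h hE] : exists h : {linear (P * Q)%type -> M}, h =1 fun x => h1 x.1 + h2 x.2.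
  apply: linear_pack => a x y; rewrite !linearP /= scalerDr.
  by rewrite !addrA; congr (_ + _); rewrite -!addrA; congr (_ + _); exact: addrC.
exists h => x; rewrite hE linearD h1E h2E /= i1E i2E -linearD; congr (g _).
by case: x => x y; congr pair; rewrite /= ?addr0 ?add0r.
Qed.

Lemma projective_free (I : finType) : projective_module {ffun I -> R^o}.
Proof.
move=> M N f g surj; pose b i : {ffun I -> R^o} := [ffun j => (j == i)%:R].
have [F FE] := choice (fun i => surj (g (b i))).
have [h hE] : exists h : {linear {ffun I -> R^o} -> M}, h =1 fun t => \sum_i t i *: F i.
  apply: linear_pack => a x y; rewrite scaler_sumr -big_split; apply: eq_bigr => i _.
  by rewrite !ffunE scalerDl scalerA.
exists h => t; rewrite hE linear_sum.
have {2}-> : t = \sum_i t i *: b i.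
  apply/ffunP => j; rewrite sum_ffunE (bigD1 j) //= !ffunE eqxx big1.
    by rewrite addr0 [RHS]mulr1.
  by move=> i ij; rewrite !ffunE eq_sym (negbTE ij) [LHS]mulr0.
by rewrite linear_sum; apply: eq_bigr => i _; rewrite !linearZ FE.
Qed.

(** [x - s (D x)] lies in the kernel of [D], hence in the image of [D'], and lifts to [s']. On the
    image of [D'] the correction [s (D x)] vanishes. *)
Lemma splitting_step (B C C' : lmodType R) (D : {linear C -> B}) (D' : {linear C' -> C})
    (s : {linear B -> C}) :
  projective_module C -> exact_at D' D -> (forall x, D (s (D x)) = D x) ->
  exists s' : {linear C -> C'}, forall x, D' (s' (D' x)) = D' x.
Proof.
move=> projC ex Ds.
have [q qE] : exists q : {linear C -> C}, q =1 fun x => x - s (D x).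
  apply: linear_pack => a x y; rewrite (linearP D) (linearP s) /= scalerBr opprD.
  by rewrite !addrA; congr (_ + _); rewrite -!addrA; congr (_ + _); exact: addrC.
have [x|s' s'E] := @projective_lift _ _ _ _ D' q projC.
  by apply/ex; rewrite qE linearB /= Ds subrr.
exists s' => x; rewrite s'E qE.
have -> : D (D' x) = 0 by apply/ex; exists x.
by rewrite linear0 subr0.
Qed.

Section Cone.
Variables (P0 P1 T0 T1 : lmodType R).
Variables (dP : {linear P1 -> P0}) (dT : {linear T1 -> T0}) (f : {linear T1 -> P0}).

(** One map of the mapping cone; the sign makes consecutive maps compose to zero. *)
Definition cone (x : P1 * T1) : P0 * T0 := (dP x.1 + f x.2, - dT x.2).

Fact cone_is_linear : linear cone.
Proof.
move=> a x y; congr pair; rewrite /= !linearP //=.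
by rewrite scalerDr !addrA; congr (_ + _); rewrite -!addrA; congr (_ + _); exact: addrC.
Qed.

HB.instance Definition _ :=
  GRing.isLinear.Build R (P1 * T1)%type (P0 * T0)%type _ cone cone_is_linear.

Lemma coneE x t :
  (cone : {linear (P1 * T1)%type -> (P0 * T0)%type}) (x, t) = (dP x + f t, - dT t).
Proof. by []. Qed.

End Cone.

Lemma cone_exact (P0 P1 P2 T0 T1 T2 : lmodType R)
    (dP : {linear P1 -> P0}) (dP' : {linear P2 -> P1})
    (dT : {linear T1 -> T0}) (dT' : {linear T2 -> T1})
    (f : {linear T1 -> P0}) (f' : {linear T2 -> P1}) :
  exact_at dP' dP -> exact_at dT' dT -> (forall t, dP (f' t) = f (dT' t)) ->
  exact_at (cone dP' dT' f') (cone dP dT f).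
Proof.
move=> exP exT comm [x t]; split=> [[/= e1 e2]|[[y u] [<- <-]]]; last first.
  rewrite coneE linearD linearN comm addrK linearN opprK.
  have -> : dP (dP' y) = 0 by apply/exP; exists y.
  by have -> : dT (dT' u) = 0 by apply/exT; exists u.
have /exT[u uE] : dT t = 0 by apply/eqP; rewrite -oppr_eq0 e2.
have /exP[y yE] : dP (x + f' u) = 0 by rewrite linearD comm uE.
exists (y, - u); rewrite coneE yE linearN addrK linearN opprK uE.
by [].
Qed.

(* The mapping cone of a comparison map T -> P is an exact complex of
   projectives bounded below, hence split; above degree p it is T. *)
Lemma split_above_pdim (M : lmodType R) p
    (T : nat -> lmodType R) (dT : forall i, {linear T i.+1 -> T i})
    (eT : {linear T 0%N -> M}) :
  has_projective_resolution M p ->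
  (forall i, projective_module (T i)) ->
  (forall y, exists x, eT x = y) -> exact_at (dT 0%N) eT ->
  (forall i, exact_at (dT i.+1) (dT i)) ->
  exists h : {linear T p -> T p.+1}, forall x, dT p (h (dT p x)) = dT p x.
Proof.
move=> [P [dP [eP [projP P0 surjP exP0 exP]]]] projT surjT exT0 exT.
(* The induction carries the comparison maps of two consecutive degrees and a splitting of the
   cone. *)
have split_at i : exists (f : {linear T i -> P i}) (f' : {linear T i.+1 -> P i.+1})
    (s : {linear (P i.+1 * T i)%type -> (P i.+2 * T i.+1)%type}),
    (forall t, dP i (f' t) = f (dT i t)) /\
    (forall x, cone (dP i.+1) (dT i) f' (s (cone (dP i.+1) (dT i) f' x)) =
               cone (dP i.+1) (dT i) f' x).
  elim: i => [|i [f [f' [s [ff' sE]]]]].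
    have [f fE] := projective_lift (projT 0%N) (fun t => surjP (eT t)).
    have [t|f' f'E] := @projective_lift _ _ _ _ (dP 0%N) (f \o dT 0%N) (projT 1%N).
      by apply/exP0; rewrite /= fE; apply/exT0; exists t.
    (* [D] is the last map of the cone, onto the projective [P 0]; its section starts the
       splittings. *)
    have [D DE] : exists D : {linear (P 1%N * T 0%N)%type -> P 0%N},
        D =1 fun x => dP 0%N x.1 + f x.2.
      apply: linear_pack => a x y; rewrite !linearP /= scalerDr !addrA; congr (_ + _).
      by rewrite -!addrA; congr (_ + _); exact: addrC.
    have [y|s sE] := @projective_lift _ _ _ _ D (idfun : {linear P 0%N -> P 0%N}) (projP 0%N).
      have [t tE] := surjT (eP y).
      have /exP0[x xE] : eP (y - f t) = 0 by rewrite linearB fE tE subrr.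
      by exists (x, t); rewrite DE /= xE subrK.
    have [||x|s' s'E] := @splitting_step _ _ _ D (cone (dP 1%N) (dT 0%N) f') s.
    - exact: projective_prod.
    - move=> [x t]; rewrite DE /=; split=> [e|[[y u] [<- <-]]]; last first.
        rewrite linearD linearN f'E /= addrK.
        by apply/exP; exists y.
      have /exT0[u uE] : eT t = 0.
        rewrite -fE; have /exP0 : exists x, dP 0%N x = f t.
          by exists (- x); rewrite linearN; apply/eqP; rewrite eq_sym -addr_eq0 addrC e.
        by [].
      have /exP[y yE] : dP 0%N (x + f' u) = 0 by rewrite linearD f'E /= uE.
      by exists (y, - u); rewrite coneE yE linearN addrK linearN opprK uE.
    - by rewrite sE.
    by exists f, f', s'.
  have [t|f'' f''E] := @projective_lift _ _ _ _ (dP i.+1) (f' \o dT i.+1) (projT i.+2).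
    apply/exP; rewrite /= ff'.
    have -> : dT i (dT i.+1 t) = 0 by apply/exT; exists t.
    by rewrite linear0.
  have [||s' s'E] := splitting_step (D' := cone (dP i.+2) (dT i.+1) f'') _ _ sE.
  - exact: projective_prod.
  - by apply: cone_exact => // t; rewrite f''E.
  by exists f', f'', s'.
have [f [f' [s [_ sE]]]] := split_at p.
have [h hE] : exists h : {linear T p -> T p.+1}, h =1 fun u => - (s (0, u)).2.
  apply: linear_pack => a x y.
  have -> : (0, a *: x + y) = a *: (0, x) + (0, y) :> P p.+1 * T p.
    by congr pair; rewrite /= scaler0 addr0.
  by rewrite linearP /= opprD scalerN.
(* As [P p.+1] is zero, the cone sends [(0, - x)] to [(0, dT p x)]. The second component of [sE]
   there is the claim. *)
exists h => x; have e : cone (dP p.+1) (dT p) f' (0, - x) = (0, dT p x).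
  by rewrite coneE (linearN (dT p)) opprK; congr pair; apply: P0.
have := congr1 snd (sE (0, - x)); rewrite e hE linearN.
by case: (s _) => y u; rewrite coneE.
Qed.

End Projectives.

(** * The Taylor complex *)

Lemma big_mlcm_le n (I : Type) (s : seq I) (P : pred I) (F : I -> 'X_{1..n}) u :
  (\big[@mlcm n/0%MM]_(a <- s | P a) F a <= u)%MM = all (fun a => P a ==> (F a <= u)%MM) s.
Proof.
elim: s => [|a s IH]; first by rewrite big_nil /=; apply/mnm_lepP => i; rewrite mnm0E.
by rewrite big_cons /= -IH; case: (P a) => //=; rewrite lem_mlcm.
Qed.

Lemma lepm_anti n (u v : 'X_{1..n}) : (u <= v)%MM -> (v <= u)%MM -> u = v.
Proof.
move=> /mnm_lepP uv /mnm_lepP vu; apply/mnmP => i.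
by apply/eqP; rewrite eqn_leq uv vu.
Qed.

Lemma lepm_subLR n (d u v : 'X_{1..n}) : (v <= u)%MM -> (d <= u - v)%MM = (d + v <= u)%MM.
Proof.
move=> /mnm_lepP vu; apply/mnm_lepP/mnm_lepP => h i; have := h i; have := vu i.
  by rewrite mnmBE mnmDE; lia.
by rewrite mnmBE mnmDE; lia.
Qed.

Lemma mcoeffXM (K : fieldType) n (p : {mpoly K[n]}) d v :
  ('X_[d] * p)@_v = if (d <= v)%MM then p@_(v - d) else 0.
Proof.
rewrite mulrC; case: ifPn => [dv|ndv].
  by rewrite -{1}(submK dv) addmC mcoeffMX.
apply: memN_msupp_eq0; apply: contra ndv.
by rewrite (perm_mem (msuppMX p d)) => /mapP[w _ ->]; apply: lem_addr.
Qed.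

Lemma sum_antisym (V : zmodType) k (F : 'I_k -> 'I_k -> V) :
  (forall a, F a a = 0) -> (forall a b, a != b -> F a b = - F b a) ->
  \sum_a \sum_b F a b = 0.
Proof.
move=> F0 FN.
have -> : \sum_a \sum_b F a b =
    \sum_(a : 'I_k) \sum_(b : 'I_k | (a < b)%N) F a b +
    \sum_(a : 'I_k) \sum_(b : 'I_k | (b < a)%N) F a b.
  rewrite -big_split; apply: eq_bigr => a _.
  rewrite (bigID (fun b : 'I_k => (a < b)%N)) /=; congr (_ + _).
  rewrite (bigD1 a) ?ltnn //= F0 add0r; apply: eq_bigl => b.
  by rewrite -leqNgt ltn_neqAle andbC.
rewrite [X in _ + X](exchange_big_dep predT) //= -big_split big1 // => a _ /=.
rewrite -big_split big1 // => b ab /=; rewrite FN ?addNr //.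
by rewrite -val_eqE neq_ltn ab.
Qed.

Section Taylor.
Variables (K : fieldType) (n k : nat) (m : 'I_k -> 'X_{1..n}).
Local Notation S := {mpoly K[n]}.
Implicit Types (a b : 'I_k) (B C : {set 'I_k}) (t x y : {set 'I_k} -> S) (u w : 'X_{1..n}).

Definition lcms B : 'X_{1..n} := \big[@mlcm n/0%MM]_(a in B) m a.

Lemma lcms_le B u : reflect (forall a, a \in B -> (m a <= u)%MM) (lcms B <= u)%MM.
Proof.
rewrite /lcms big_mlcm_le; apply: (iffP allP) => h a; last by move=> _; apply/implyP/h.
by move=> aB; apply: (implyP (h a _)) => //; rewrite mem_index_enum.
Qed.

Lemma lcms0 : lcms set0 = 0%MM.
Proof. by rewrite /lcms big_set0. Qed.

Lemma lcmsU1_le a B u : (lcms (a |: B) <= u)%MM = (m a <= u)%MM && (lcms B <= u)%MM.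
Proof.
apply/lcms_le/andP => [h|[ha /lcms_le hB] b].
  by split; [apply: h; rewrite setU11|apply/lcms_le => b bB; apply: h; rewrite setU1r].
by rewrite in_setU1 => /orP[/eqP->|/hB].
Qed.

Lemma le_lcms a B : a \in B -> (m a <= lcms B)%MM.
Proof. by move=> aB; have /lcms_le := lepm_refl (lcms B); apply. Qed.

Lemma lcmsU1_ge a B : (lcms B <= lcms (a |: B))%MM.
Proof. by have := lepm_refl (lcms (a |: B)); rewrite lcmsU1_le => /andP[]. Qed.

Definition sgn a B : K := (-1) ^+ #|[set b in B | (b < a)%N]|.

Lemma sgnU1 a b B : a \notin B -> sgn b (a |: B) = (-1) ^+ (a < b)%N * sgn b B.
Proof.
move=> aB; rewrite /sgn -exprD; congr (_ ^+ _).
rewrite (cardsD1 a) !inE eqxx /=; congr addn; apply: eq_card => c; rewrite !inE.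
by case: (eqVneq c a) => [->|]; rewrite ?(negbTE aB).
Qed.

Lemma sgn_sq a B : sgn a B * sgn a B = 1.
Proof. by rewrite -expr2 sqrr_sign. Qed.

Lemma sgn_swap a b B : a != b -> a \notin B -> b \notin B ->
  sgn a B * sgn b (a |: B) = - (sgn b B * sgn a (b |: B)).
Proof.
move=> ab aB bB; rewrite !sgnU1 // mulrCA [sgn b B * _]mulrCA [sgn b B * _]mulrC -mulNr.
congr (_ * _); have : (a : nat) != b by [].
by rewrite neq_ltn => /orP[] h; rewrite h ltnNge (ltnW h) /= ?expr0 ?expr1 ?opprK.
Qed.

Lemma sgn_cross a b B : a != b -> a \notin B -> b \notin B ->
  sgn b (a |: B) * sgn a (b |: B) = - (sgn a B * sgn b B).
Proof.
move=> ab aB bB; rewrite -[LHS]mul1r -(sgn_sq a B) mulrACA sgn_swap //.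
by rewrite mulNr mulrACA sgn_sq mulr1 mulrC.
Qed.

(** The Taylor differential in all degrees at once, read on coefficients: the basis element of [C]
    goes to the signed sum, over [a] in [C], of those of [C :\ a] times the quotient of the two
    lcms. *)
Definition tdiff t B : S :=
  \sum_(a | a \notin B) sgn a B *: ('X_[lcms (a |: B) - lcms B] * t (a |: B)).

(* The coefficient of t B in multidegree u, the basis element B having
   multidegree [lcms B]. *)
Definition tcoef t B u : K := if (lcms B <= u)%MM then (t B)@_(u - lcms B) else 0.

Lemma tcoefP t t' B : (forall u, tcoef t B u = tcoef t' B u) -> t B = t' B.
Proof.
move=> h; apply/mpolyP => w; have := h (w + lcms B)%MM.
by rewrite /tcoef lem_addl addmK.
Qed.

Lemma tcoef_diff t B u :
  tcoef (tdiff t) B u = \sum_(a | a \notin B) sgn a B * tcoef t (a |: B) u.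
Proof.
rewrite /tcoef; case: ifPn => [lu|nlu]; last first.
  rewrite big1 // => a _; rewrite lcmsU1_le (negbTE nlu) andbF mulr0.
  by [].
rewrite /tdiff raddf_sum; apply: eq_bigr => a _ /=; rewrite mcoeffZ mcoeffXM.
rewrite (lepm_subLR (lcms (a |: B) - lcms B)%MM lu); rewrite (submK (lcmsU1_ge a B)).
case: (lcms (a |: B) <= u)%MM; last by [].
congr (_ * _@_ _); apply/mnmP => i; rewrite !mnmBE.
by rewrite -subnDA subnKC //; apply/mnm_lepP: i; apply: lcmsU1_ge.
Qed.

(** Removing two generators in either order gives opposite signs. *)
Lemma tdiff_tdiff t B : tdiff (tdiff t) B = 0.
Proof.
apply: (@tcoefP _ (fun _ => 0)) => u; rewrite [RHS]/tcoef mcoeff0 if_same tcoef_diff.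
under eq_bigr => a _ do rewrite tcoef_diff big_distrr big_mkcond /=.
rewrite big_mkcond /=.
pose F a b := if (a \notin B) && (b \notin a |: B)
  then sgn a B * (sgn b (a |: B) * tcoef t (b |: (a |: B)) u) else 0.
rewrite (eq_bigr (fun a => \sum_b F a b)); last first.
  move=> a _; rewrite /F; case: (a \notin B); first by apply: eq_bigr => b _.
  by rewrite big1.
apply: sum_antisym => [a|a b ab]; first by rewrite /F setU11 andbF.
rewrite /F !in_setU1 !negb_or ab [b == a]eq_sym ab /= [(b \notin B) && _]andbC.
case: ifPn => [/andP[aB bB]|]; last by rewrite oppr0.
by rewrite !mulrA sgn_swap // mulNr setUCA.
Qed.

(* In multidegree u the complex is that of a full simplex, contracted to any
   generator dividing u. *)
Lemma tdiff_exact x : (forall B, tdiff x B = 0) ->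
  (forall u, u \in msupp (x set0) -> exists a, (m a <= u)%MM) ->
  exists y, forall B, tdiff y B = x B.
Proof.
move=> dx0 x0.
have cdx B u : \sum_(a | a \notin B) sgn a B * tcoef x (a |: B) u = 0.
  by rewrite -tcoef_diff /tcoef dx0 mcoeff0 if_same.
(* [al u] is the cone point in multidegree [u]; [cy] is the homotopy that adjoins it. [D] bounds the
   degrees in [x], so that [y] is polynomial. *)
pose al u := [pick a | (m a <= u)%MM].
pose cy C u : K := if al u is Some a then
  if a \in C then sgn a (C :\ a) * tcoef x (C :\ a) u else 0 else 0.
pose D := (\max_B msize (x B))%N.
pose y C : S := \sum_(w : 'X_{1..n < D}) cy C (w + lcms C)%MM *: 'X_[w].
have yE C u : tcoef y C u = cy C u.
  rewrite /tcoef; case: ifPn => [lu|nlu]; last first.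
    rewrite /cy /al; case: pickP => // a au; case: ifPn => // aC.
    rewrite /tcoef; case: ifPn; rewrite ?mulr0 // => lu.
    by case/negP: nlu; rewrite -(setD1K aC) lcmsU1_le au.
  rewrite -[in RHS](submK lu); have [lt|ge] := ltnP (mdeg (u - lcms C)) D.
    by rewrite /y (mcoeff_mpoly (fun w => cy C (w + lcms C)%MM)).
  have -> : (y C)@_(u - lcms C) = 0.
    rewrite /y raddf_sum big1 // => w _ /=; rewrite mcoeffZ mcoeffX.
    case: eqP => [e|_]; last by rewrite mulr0.
    by have := bmdeg w; rewrite e ltnNge ge.
  rewrite /cy; case: (al _) => // a; case: ifPn => // aC; rewrite /tcoef submK //.
  case: ifPn; rewrite ?mulr0 // => lu'; rewrite memN_msupp_eq0 ?mulr0 //.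
  apply: msize_mdeg_ge; apply: leq_trans (leq_trans (leq_bigmax (C :\ a)) ge) _.
  rewrite !mdegE; apply: leq_sum => i _; rewrite !mnmBE leq_sub2l //.
  by apply/mnm_lepP: i; rewrite -{2}(setD1K aC) lcmsU1_ge.
exists y => B; apply: tcoefP => u; rewrite tcoef_diff.
under eq_bigr => a _ do rewrite yE.
(* If no generator divides [X^u], only the empty set could contribute, and [x0] excludes it. *)
rewrite /cy /al; case: pickP => [a au|nu]; last first.
  rewrite big1 => [|b _]; last by rewrite mulr0.
  rewrite /tcoef; case: ifPn => // lu; have [e|[b bB]] := set_0Vmem B.
    rewrite e in lu *; apply/esym/memN_msupp_eq0/negP => /x0[b bu].
    have := nu b; rewrite (lepm_trans bu) //.
    by apply/mnm_lepP => i; rewrite mnmBE leq_subr.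
  by have := nu b; move/lcms_le: lu => /(_ b bB) ->.
(* For [a] outside [B] only the summand of [a] survives; for [a] in [B] the claim is the cycle
   condition at [B :\ a]. *)
have [aB|aB] := boolP (a \in B); last first.
  rewrite (bigD1 a) //= setU11 setU1K // mulrA sgn_sq mul1r big1 ?addr0 //.
  move=> b /andP[bB ba]; rewrite in_setU1 eq_sym (negbTE ba) (negbTE aB) mulr0.
  by [].
have := cdx (B :\ a) u; rewrite (bigD1 a) ?setD11 //= setD1K //.
move=> /(congr1 ( *%R (sgn a (B :\ a)))); rewrite mulr0 mulrDr mulrA sgn_sq mul1r.
move=> /eqP; rewrite addr_eq0 => /eqP->; rewrite big_distrr -sumrN.
rewrite (eq_bigl (fun b => (b \notin B :\ a) && (b != a))) => [|b]; last first.
  by rewrite in_setD1 negb_and negbK; case: eqVneq => [->|]; rewrite ?aB ?andbT.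
apply: eq_bigr => b /andP[bB ba]; rewrite in_setU1 aB orbT.
have -> : (b |: B) :\ a = b |: (B :\ a).
  apply/setP => c; rewrite !inE; case: eqVneq => [->|_] //=.
  by rewrite eq_sym (negbTE ba).
rewrite -{1}(setD1K aB) !mulrA sgn_cross ?setD11 //; last first.
  by rewrite eq_sym.
by rewrite mulNr /= mulrA.
Qed.

End Taylor.

Section TaylorResolution.
Variables (K : fieldType) (n k : nat) (m : 'I_k -> 'X_{1..n}).
Local Notation S := {mpoly K[n]}.
Local Notation lcms := (lcms m).
Local Notation tdiff := (tdiff m).
Implicit Types (B C : {set 'I_k}) (a b : 'I_k) (x : {set 'I_k} -> S).

Definition taylor i : lmodType S := {ffun {B : {set 'I_k} | #|B| == i} -> S^o}.

(* [ext] and [restr] identify the degree i part with the functions on all sets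
   that vanish outside the sets of size i. *)
Definition ext i (t : taylor i) B : S :=
  if insub B is Some B' then t B' else 0.

Definition restr i (x : {set 'I_k} -> S) : taylor i := [ffun B => x (val B)].

Lemma ext_val i (t : taylor i) (B : {B : {set 'I_k} | #|B| == i}) : ext t (val B) = t B.
Proof. by rewrite /ext valK. Qed.

Lemma ext_out i (t : taylor i) B : #|B| != i -> ext t B = 0.
Proof. by move=> Bi; rewrite /ext insubN. Qed.

Lemma ext_restr i x B : #|B| = i -> ext (restr i x) B = x B.
Proof. by move=> /eqP Bi; rewrite /ext insubT ffunE. Qed.

Lemma extP i c (t t' : taylor i) B : ext (c *: t + t') B = c * ext t B + ext t' B.
Proof.
rewrite /ext; case: insubP => [B' _ _|_]; last by rewrite mulr0 addr0.
by rewrite !ffunE.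
Qed.

Lemma extD i (t t' : taylor i) B : ext (t + t') B = ext t B + ext t' B.
Proof. by rewrite -[t]scale1r extP mul1r scale1r. Qed.

Lemma eq_ext i (t t' : taylor i) : ext t =1 ext t' -> t = t'.
Proof. by move=> tt'; apply/ffunP => B; rewrite -!ext_val tt'. Qed.

Lemma eq_tdiff x y B : (forall a, a \notin B -> x (a |: B) = y (a |: B)) ->
  tdiff x B = tdiff y B.
Proof. by move=> xy; apply: eq_bigr => a /xy->. Qed.

Lemma tdiff_out i x B : (forall C, #|C| != i.+1 -> x C = 0) -> #|B| != i -> tdiff x B = 0.
Proof.
move=> x0 Bi; apply: big1 => a aB; rewrite x0 ?mulr0 ?scaler0 //.
by rewrite cardsU1 aB.
Qed.

Definition taylor_diff_fun i (t : taylor i.+1) : taylor i := restr i (tdiff (ext t)).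

Fact taylor_diff_linear i : linear (@taylor_diff_fun i).
Proof.
move=> a t t'; apply/ffunP => B; rewrite !ffunE scaler_sumr -big_split.
apply: eq_bigr => b _; rewrite extP mulrDr scalerDr; congr (_ + _).
by rewrite mulrCA scalerAr.
Qed.

HB.instance Definition _ i := GRing.isLinear.Build S (taylor i.+1) (taylor i) _
  (@taylor_diff_fun i) (@taylor_diff_linear i).

Definition taylor_diff i : {linear taylor i.+1 -> taylor i} := @taylor_diff_fun i.

Lemma ext_diff i (t : taylor i.+1) : ext (taylor_diff i t) =1 tdiff (ext t).
Proof.
move=> B; have [Bi|Bi] := eqVneq #|B| i; first exact: ext_restr.
by rewrite ext_out // (@tdiff_out i) // => C Ci; rewrite ext_out.
Qed.

Lemma ext0 i : ext (0 : taylor i) =1 fun=> 0.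
Proof. by move=> B; rewrite /ext; case: insubP => // B' _ _; rewrite ffunE. Qed.

(** The preimage given by [tdiff_exact] may live on sets of all sizes, but only its entries of size
    [i.+1] affect those of size [i]. *)
Lemma taylor_lift i (y : taylor i) :
  (forall B, tdiff (ext y) B = 0) ->
  (forall u, u \in msupp (ext y set0) -> exists a, (m a <= u)%MM) ->
  exists t, taylor_diff i t = y.
Proof.
move=> y0 yu; have [x xE] := tdiff_exact y0 yu.
exists (restr i.+1 x); apply: eq_ext => B; rewrite ext_diff.
have [Bi|Bi] := eqVneq #|B| i; last first.
  by rewrite ext_out // (@tdiff_out i) // => C Ci; rewrite ext_out.
rewrite -xE; apply: eq_tdiff => a aB; apply: ext_restr.
by rewrite cardsU1 aB Bi.
Qed.

Lemma taylor_exact i : exact_at (taylor_diff i.+1) (taylor_diff i).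
Proof.
move=> y; split=> [y0|[x <-]].
  apply: taylor_lift => [B|u]; first by rewrite -ext_diff y0 ext0.
  by rewrite ext_out ?cards0 // msupp0.
apply: eq_ext => B; rewrite ext_diff ext0.
rewrite (@eq_tdiff _ (tdiff (ext x))) ?tdiff_tdiff // => a _.
by rewrite ext_diff.
Qed.

Lemma projective_taylor i : projective_module (taylor i).
Proof. exact: projective_free. Qed.

Lemma taylor_eq0 i : (k < i)%N -> forall x : taylor i, x = 0.
Proof.
move=> ki x; apply/ffunP => -[B Bi]; exfalso.
by have := max_card B; rewrite (eqP Bi) card_ord leqNgt ki.
Qed.

Variable J : monomialIdeal K n.
Hypothesis memJ : forall u : 'X_{1..n}, 'X_[u] \in (J : {pred S}) <-> exists a, (m a <= u)%MM.

Definition taylor_aug_fun (t : taylor 0) : {ideal_quot J} := \pi_{ideal_quot J} (ext t set0).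

Fact taylor_aug_linear : linear taylor_aug_fun.
Proof. by move=> a t t'; rewrite /taylor_aug_fun extP rmorphD rmorphM. Qed.

HB.instance Definition _ := GRing.isLinear.Build S (taylor 0) {ideal_quot J} _
  taylor_aug_fun taylor_aug_linear.

Definition taylor_aug : {linear taylor 0 -> {ideal_quot J}} := taylor_aug_fun.

Lemma taylor_aug_surj y : exists t, taylor_aug t = y.
Proof.
exists (restr 0 (fun=> repr y)); rewrite /= /taylor_aug_fun ext_restr ?cards0 //.
exact: reprK.
Qed.

Lemma taylor_aug_exact : exact_at (taylor_diff 0) taylor_aug.
Proof.
move=> t; split=> [/quot_eq0P tJ|[x <-]].
  apply: taylor_lift => [B|u ut]; last by apply/memJ; apply: mideal_msupp ut.
  by apply: big1 => a aB; rewrite ext_out ?mulr0 ?scaler0 // cardsU1 aB.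
apply/quot_eq0P; rewrite ext_diff; apply: rpred_sum => a _.
rewrite -mul_mpolyC; apply: idealMr; rewrite mulrC; apply: idealMr.
by apply/memJ; exists a; rewrite lcms0 subm0 le_lcms ?setU11.
Qed.

Lemma taylor_resolution : has_projective_resolution {ideal_quot J} k.
Proof.
exists taylor, taylor_diff, taylor_aug; split.
- exact: projective_taylor.
- exact: taylor_eq0.
- exact: taylor_aug_surj.
- exact: taylor_aug_exact.
- exact: taylor_exact.
Qed.

(** Tuples without constant terms form the ideal of the variables times the free module, which
    linear maps respect. *)
Lemma mcoeff0_linear i j (h : {linear taylor i -> taylor j}) (t : taylor i) :
  (forall D, (t D)@_0%MM = 0) -> forall D, (h t D)@_0%MM = 0.
Proof.
move=> t0 D'; pose e D : taylor i := [ffun D' => (D' == D)%:R].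
have {1}-> : t = \sum_D t D *: e D.
  apply/ffunP => D; rewrite sum_ffunE (bigD1 D) //= !ffunE eqxx big1.
    by rewrite addr0 [RHS]mulr1.
  by move=> E ED; rewrite !ffunE eq_sym (negbTE ED) [LHS]mulr0.
rewrite linear_sum sum_ffunE raddf_sum big1 //= => D _.
by rewrite linearZ ffunE rmorphM /= t0 mul0r.
Qed.

(** A monomial factor survives modulo the variables iff it is 1, that is, iff [m a] divides the lcm
    of [B]. *)
Lemma mcoeff0_tdiff x B : (tdiff x B)@_0%MM =
  \sum_(a | a \notin B) sgn K a B * ((m a <= lcms B)%MM%:R * (x (a |: B))@_0%MM).
Proof.
have := tcoef_diff m x B (lcms B); rewrite {1}/tcoef lepm_refl.
have -> : (lcms B - lcms B = 0)%MM by apply/mnmP => i; rewrite mnmBE mnm0E subnn.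
move=> ->; apply: eq_bigr => a _; congr (_ * _).
rewrite /tcoef lcmsU1_le lepm_refl andbT; case: ifPn => aB; last by rewrite mul0r.
rewrite mul1r; congr (_@_ _); apply/mnmP => i; rewrite mnmBE mnm0E; apply/eqP.
by rewrite subn_eq0; apply/mnm_lepP: i; apply: lcmsU1_ge.
Qed.

(* Modulo the variables, the degree p + 1 cycle x is the boundary of z times the
   only basis element of degree k. *)
Lemma constant_cycle_boundary p (x : {set 'I_k} -> K) : k = p.+2 ->
  has_projective_resolution {ideal_quot J} p ->
  (forall C, #|C| = p ->
    \sum_(a | a \notin C) sgn K a C * ((m a <= lcms C)%MM%:R * x (a |: C)) = 0) ->
  exists z, forall a : 'I_k, x (~: [set a]) =
    sgn K a (~: [set a]) * ((m a <= lcms (~: [set a]))%MM%:R * z).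
Proof.
move=> kp res x0.
have [h hE] := split_above_pdim res projective_taylor taylor_aug_surj
  taylor_aug_exact taylor_exact.
pose t : taylor p.+1 := restr p.+1 (fun B => (x B)%:MP).
have dt0 D : (taylor_diff p t D)@_0%MM = 0.
  rewrite -ext_val ext_diff mcoeff0_tdiff -[RHS](x0 (val D)); last exact: (eqP (valP D)).
  apply: eq_bigr => a aB; congr (_ * (_ * _)); rewrite ext_restr.
    by rewrite mcoeffC eqxx mulr1.
  by rewrite cardsU1 aB (eqP (valP D)).
(* The correction [h (taylor_diff p t)] has no constant terms, by [dt0] and [mcoeff0_linear]. So [t]
   and the boundary of [y] have the same ones. *)
have /taylor_exact[y yE] : taylor_diff p (t - h (taylor_diff p t)) = 0.
  by rewrite linearB hE subrr.
exists (ext y setT)@_0%MM => a.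
have cardCa : #|~: [set a]| = p.+1 by have := cardsC [set a]; rewrite cards1 card_ord; lia.
have <- : (ext t (~: [set a]))@_0%MM = x (~: [set a]).
  by rewrite ext_restr // mcoeffC eqxx mulr1.
have -> : t = taylor_diff p.+1 y + h (taylor_diff p t) by rewrite yE subrK.
rewrite extD ext_diff mcoeffD mcoeff0_tdiff.
have -> : (ext (h (taylor_diff p t)) (~: [set a]))@_0%MM = 0.
  have /eqP e := cardCa.
  by rewrite -[~: _]/(val (exist (fun B : {set 'I_k} => #|B| == p.+1) _ e)) ext_val mcoeff0_linear.
rewrite addr0 (big_pred1 a) => [|b]; last by rewrite !inE negbK.
by rewrite setUCr.
Qed.

End TaylorResolution.

(** * The graph of redundant generators *)

Lemma lcms_sub n k (m : 'I_k -> 'X_{1..n}) (B C : {set 'I_k}) :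
  B \subset C -> (lcms m B <= lcms m C)%MM.
Proof. by move=> /subsetP BC; apply/lcms_le => a /BC; apply: le_lcms. Qed.

(** If all members of [B] had a smaller exponent at [x], the lcm lowered at [x] would still be a
    common multiple. *)
Lemma dominated_lcms n k (m : 'I_k -> 'X_{1..n}) W b (B : {set 'I_k}) :
  (m b <= lcms m B)%MM -> dominated W m b B.
Proof.
move=> /mnm_lepP mb x _ mbx.
have [/exists_inP[a aB ab]|/exists_inPn no] := boolP [exists a in B, (m b x <= m a x)%N].
  by exists a.
pose u := [multinom if i == x then (m b x).-1 else lcms m B i | i < n].
have /mnm_lepP/(_ x) : (lcms m B <= u)%MM.
  apply/lcms_le => a aB; apply/mnm_lepP => i; rewrite mnmE.
  case: eqP => [->|_]; first by have := no a aB; rewrite -ltnNge; lia.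
  by have /mnm_lepP := le_lcms m aB; apply.
by rewrite mnmE eqxx; have := mb x; lia.
Qed.

Section TreeOfResolution.
Variables (K : fieldType) (n k : nat) (m : 'I_k -> 'X_{1..n}) (J : monomialIdeal K n).
Local Notation S := {mpoly K[n]}.
Hypothesis memJ : forall u : 'X_{1..n}, 'X_[u] \in (J : {pred S}) <-> exists a, (m a <= u)%MM.
Variable p : nat.
Hypothesis kp : k = p.+2.
Hypothesis res : has_projective_resolution {ideal_quot J} p.
Implicit Types (a b c u v : 'I_k) (B C : {set 'I_k}).

Let dom b B := (m b <= lcms m B)%MM.

Definition redundant : {set 'I_k} := [set v | (m v <= lcms m (~: [set v]))%MM].

Definition redundant_edge : rel 'I_k := fun a b =>
  (m a <= lcms m (~: [set a; b]))%MM || (m b <= lcms m (~: [set a; b]))%MM.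

Local Notation V := redundant.
Local Notation adj := redundant_edge.

Lemma card_codim2 C : #|C| = p -> exists a b, a != b /\ C = ~: [set a; b].
Proof.
move=> Cp; have /cards2P[a [b [ab Ce]]] : #|~: C| == 2.
  by have := cardsC C; rewrite [RHS in _ = RHS -> _]card_ord Cp; lia.
by exists a, b; rewrite -Ce setCK.
Qed.

Lemma setU1_codim2 a b : a != b -> a |: ~: [set a; b] = ~: [set b].
Proof.
by move=> ab; apply/setP => c; rewrite !inE; case: eqVneq => [->|] //; rewrite ab.
Qed.

(** Otherwise the basis element of [~: [set a]] is a cycle modulo the variables, but it is no
    boundary since [a] is not redundant. *)
Lemma redundant_leaf a : a \notin V -> exists2 b, b != a & dom b (~: [set a; b]).
Proof.
rewrite inE => nVa; have [//|no] := pselect (exists2 b, b != a & dom b (~: [set a; b])).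
have [C Cp|z zE] := constant_cycle_boundary memJ (x := fun B => (B == ~: [set a])%:R) kp res.
  apply: big1 => b bC; case: eqP => [e|_]; last by rewrite !mulr0.
  have ba : b != a by have := setU11 b C; rewrite e !inE.
  have Ce : C = ~: [set a; b].
    apply/setP => c; have /setP/(_ c) := e; rewrite !inE negb_or.
    by case: eqVneq => [->|_] /=; [rewrite (negbTE bC) andbF|rewrite andbT].
  case: (boolP (m b <= _)%MM) => [mb|_]; last by rewrite mul0r mulr0.
  by case: no; exists b => //; rewrite /dom -Ce.
have /eqP := zE a; rewrite eqxx (negbTE nVa) mul0r mulr0.
by rewrite oner_eq0.
Qed.

(** Otherwise the part of the boundary of the full set carried by [V1] is a cycle modulo the
    variables. If it bounds [z] times the full set, then [z = 1] by a vertex of [V1] and [z = 0] by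
    one of [V :\: V1]. *)
Lemma redundant_connected (V1 : {set 'I_k}) : V1 \subset V -> V1 != set0 -> V1 != V ->
  exists u v, [/\ u \in V1, v \in V :\: V1 & dom v (~: [set u; v])].
Proof.
move=> sV1 V1n0 V1nV.
have [//|no] := pselect (exists u v, [/\ u \in V1, v \in V :\: V1 & dom v (~: [set u; v])]).
pose x B : K := \sum_(v in V1) (B == ~: [set v])%:R * sgn K v B.
have xE v : x (~: [set v]) = (v \in V1)%:R * sgn K v (~: [set v]).
  rewrite /x; have [vV1|nV1] := boolP (v \in V1).
    rewrite (bigD1 v) //= eqxx big1 ?addr0 // => w /andP[_ wv].
    by rewrite (inj_eq (@setC_inj _)) (inj_eq (@set1_inj _)) eq_sym (negbTE wv) mul0r.
  rewrite mul0r big1 // => w wV1.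
  rewrite (inj_eq (@setC_inj _)) (inj_eq (@set1_inj _)); case: eqP => [e|]; last by rewrite mul0r.
  by rewrite e wV1 in nV1.
have swap a b : a != b -> b \in V1 -> dom a (~: [set a; b]) ->
    (a \in V1) && dom b (~: [set a; b]).
  move=> ab bV1 da; set C := ~: [set a; b].
  have lC : (lcms m (~: [set b]) <= lcms m C)%MM.
    by rewrite -(setU1_codim2 ab) lcmsU1_le lepm_refl andbT.
  have bV : b \in V by apply: (subsetP sV1).
  have -> : dom b C by move: bV; rewrite inE => /lepm_trans; apply.
  rewrite andbT; apply/negPn/negP => aV1; apply: no; exists b, a; split=> //.
    rewrite !inE aV1 /=; apply: lepm_trans da _; apply: lcms_sub.
    by apply/subsetP => c; rewrite !inE negb_or => /andP[].
  by rewrite setUC.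
have [C Cp|z zE] := constant_cycle_boundary memJ (x := x) kp res.
  have [a [b [ab ->]]] := card_codim2 Cp; set D := ~: [set a; b].
  have ba : b != a by rewrite eq_sym.
  have aD : a \notin D by rewrite !inE eqxx.
  have bD : b \notin D by rewrite !inE eqxx orbT.
  have aU : a |: D = ~: [set b] by rewrite setU1_codim2.
  have bU : b |: D = ~: [set a] by rewrite /D (setUC [set a]) setU1_codim2.
  rewrite (bigD1 a) //= (bigD1 b) /=; last by rewrite bD ba.
  rewrite big1 ?addr0; last first.
    by move=> c; rewrite !inE negbK -andbA => /and3P[/orP[]/eqP-> //]; rewrite eqxx.
  rewrite [x (a |: D)](_ : _ = (b \in V1)%:R * sgn K b (a |: D)); last by rewrite aU xE.
  rewrite [x (b |: D)](_ : _ = (a \in V1)%:R * sgn K a (b |: D)); last by rewrite bU xE.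
  have e : dom a D && (b \in V1) = dom b D && (a \in V1).
    apply/andP/andP => -[d1 d2].
      by have /andP[] := swap a b ab d2 d1.
    have := swap b a ba d2; rewrite (setUC [set b]) => /(_ d1)/andP[].
    by [].
  rewrite !(mulrA _%:R) -!natrM !mulnb e mulrCA [X in _ + X]mulrCA -mulrDr.
  by rewrite sgn_swap // addNr mulr0.
have [u uV1] := set0Pn _ V1n0.
have uV : u \in V by apply: (subsetP sV1).
have [v vV vV1] : exists2 v, v \in V & v \notin V1.
  by apply/subsetPn; apply: contra V1nV => sV; rewrite eqEsubset sV1.
have sgn_unit a B : sgn K a B != 0 by rewrite signr_eq0.
have := zE u; rewrite xE uV1; move: uV; rewrite inE => ->; rewrite !mul1r.
rewrite -[LHS]mulr1 => /(mulfI (sgn_unit _ _)) z1.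
have /eqP := zE v; rewrite xE (negbTE vV1); move: vV; rewrite inE => ->.
by rewrite mul0r mul1r eq_sym mulf_eq0 (negbTE (sgn_unit _ _)) -z1 oner_eq0.
Qed.

Lemma redundant_adj a : a \notin V -> exists2 b, b \in V & (b != a) && adj a b.
Proof.
move=> /redundant_leaf[b ba db]; exists b; last by rewrite ba /adj orbC -/(dom b _) db.
rewrite inE; apply: lepm_trans db _; apply: lcms_sub.
by apply/subsetP => c; rewrite !inE negb_or => /andP[].
Qed.

Lemma redundant_nonempty : exists v, v \in V.
Proof.
have k0 : (0 < k)%N by rewrite kp.
have [aV|/redundant_adj[b bV _]] := boolP (Ordinal k0 \in V); first by exists (Ordinal k0).
by exists b.
Qed.

Lemma adj_sym : ssrbool.symmetric adj.
Proof. by move=> a b; rewrite /adj orbC setUC. Qed.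

Lemma redundant_linked a b : a != b -> linked V adj a b.
Proof.
have VV u v : u \in V -> v \in V -> u != v -> linked V adj u v.
  move=> uV vV uv; have [//|nl] := pselect (linked V adj u v).
  (* The part of [V] reached from [u]; an edge of [redundant_connected] leaving it would reach a
     further vertex. *)
  pose V1 := [set w in V | (w == u) || `[< linked V adj u w >]].
  have [|||w [x []]] := @redundant_connected V1.
  - by apply/subsetP => w; rewrite inE => /andP[].
  - by apply/set0Pn; exists u; rewrite inE uV eqxx.
  - apply/eqP => /setP/(_ v); rewrite inE vV eq_sym (negbTE uv) /= => /asboolP.
    exact: nl.
  rewrite in_set => /andP[wV wl]; rewrite in_setD => /andP[xV1 xV] dx.
  have wx : adj w x by rewrite /adj -/(dom x _) dx orbT.
  case/negP: xV1; rewrite in_set xV /=; apply/orP; right; apply/asboolP.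
  case/orP: wl => [/eqP<-|/asboolP wl]; first exact: linked1.
  by apply: linked_trans wV wl _; apply: linked1.
have aV u v : v \in V -> u != v -> linked V adj u v.
  move=> vV uv; have [uV|/redundant_adj[w wV /andP[wu uw]]] := boolP (u \in V).
    exact: VV.
  have [<-|wv] := eqVneq w v; first exact: linked1.
  exact: (linkedS uw wV (VV w v wV vV wv)).
move=> ab; have [bV|/redundant_adj[c cV /andP[cb bc]]] := boolP (b \in V); first exact: aV.
have cb' : linked V adj c b by apply: linked1; rewrite adj_sym.
have [->//|ac] := eqVneq a c.
exact: (linked_trans cV (aV a c cV ac) cb').
Qed.

End TreeOfResolution.

(** * Ideals with a given lcm lattice *)

Section StanleyBounds.
Variables (K : fieldType) (n k : nat) (m : 'I_k -> 'X_{1..n}) (J : monomialIdeal K n).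
Local Notation S := {mpoly K[n]}.
Hypothesis memJ : forall u : 'X_{1..n}, 'X_[u] \in (J : {pred S}) <-> exists a, (m a <= u)%MM.

Lemma spdim_quot_le d : coverable setT setT m d -> (spdim (quot_grading J) <= d)%N.
Proof.
move=> [s [ds cov]]; rewrite /spdim leq_subCl.
apply: (@quot_sdepth_ge _ _ _ s) => [u|c cs]; last first.
  by rewrite leq_subLR addnC; have := ds c cs; rewrite cardsT card_ord.
rewrite cov; congr nat_of_bool; apply/andP/negP => [[_ /forall_inP h] /memJ[a /mnm_lepP au]|uJ].
  have /exists_inP[i _] := h a (in_setT a).
  by rewrite ltnNge au.
split; first by apply/forallP => i; rewrite in_setT implybT.
apply/forall_inP => a _; apply: contrapT => /negP/exists_inPn no; apply: uJ; apply/memJ.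
by exists a; apply/mnm_lepP => i; have := no i (in_setT i); rewrite -leqNgt.
Qed.

(* J is the disjoint union over j of the multiples of m j that no earlier
   generator divides, i.e. of m j times the complement of (m a : a < j) : m j. *)
Lemma spdim_ideal_le : (0 < k)%N -> (spdim (ideal_grading J) <= k - 1)%N.
Proof.
move=> k0; pose before (j : 'I_k) : {set 'I_k} := [set a : 'I_k | (a < j)%N].
have cardb j : (#|before j| <= k - 1)%N.
  have : before j \subset [set~ j].
    by apply/subsetP => a; rewrite !inE; apply: contraTneq => ->; rewrite ltnn.
  by move=> /subset_leq_card; rewrite cardsC1 card_ord subn1.
have [s sP] := choice (fun j =>
  coverable_card setT (fun a => m a - m j)%MM (cardb j)).
pose t := flatten [seq [seq ((c.1 + m j)%MM, c.2) | c <- s j] | j : 'I_k].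
rewrite /spdim leq_subCl; apply: (@ideal_sdepth_ge _ _ _ t) => [u|c]; last first.
  move=> /flatten_mapP[j _ /mapP[c' /(sP j).1 + ->]] /=.
  by rewrite cardsT card_ord leq_subLR [(k - 1 + _)%N]addnC.
have cell j : count (in_cell u) [seq ((c.1 + m j)%MM, c.2) | c <- s j] =
    ((m j <= u)%MM && [forall a : 'I_k, (a < j)%N ==> ~~ (m a <= u)%MM]).
  rewrite count_map; have [/mnm_lepP ju|nju] := boolP (m j <= u)%MM; last first.
    rewrite /=; apply/eqP; rewrite eqn0Ngt -has_count; apply/hasPn => c _ /=.
    apply: contra nju => /forallP h; apply/mnm_lepP => i; have := h i => /=.
    by rewrite mnmDE; case: ifP => _; lia.
  transitivity (count (in_cell (u - m j)%MM) (s j)).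
    apply: eq_count => c /=; apply: eq_forallb => i; rewrite mnmDE mnmBE.
    by have := ju i; case: ifP => _; lia.
  rewrite (sP j).2 /= /avoids; congr nat_of_bool.
  rewrite [X in X && _](_ : _ = true); last by apply/forallP => i; rewrite in_setT implybT.
  rewrite /=; apply/forall_inP/forallP => [h a|h a].
    apply/implyP => aj; apply/negP => /mnm_lepP au.
    have /exists_inP[i _] : [exists i in setT, ((u - m j)%MM i < (m a - m j)%MM i)%N].
      by apply: h; rewrite inE.
    by rewrite !mnmBE; have := au i; lia.
  rewrite inE => aj; have := h a; rewrite aj /=; apply: contraR => /exists_inPn no.
  apply/mnm_lepP => i; have := no i (in_setT i); rewrite !mnmBE -leqNgt.
  by have := ju i; lia.
have [/memJ[a0 a0u]|uJ] := boolP ('X_[u] \in _); last first.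
  rewrite /t count_flatten -map_comp sumnE big_map big1 // => j _ /=.
  rewrite cell; case: (boolP (m j <= u)%MM) => //= ju; case/negP: uJ.
  by apply/memJ; exists j.
(* The block of the least generator index dividing [X^u] is the only one that contains [u]. *)
have [j ju jmin] := @arg_minnP _ a0 (fun a => (m a <= u)%MM) (fun a : 'I_k => a : nat) a0u.
rewrite /t count_flatten -map_comp sumnE big_map big_enum (bigD1 j) //= cell ju /=.
have -> : [forall a : 'I_k, (a < j)%N ==> ~~ (m a <= u)%MM].
  apply/forallP => a; apply/implyP => aj; apply/negP => /jmin.
  by rewrite leqNgt aj.
rewrite big1 ?addn0 // => i ij; rewrite cell; apply/eqP; rewrite eqb0 negb_and.
case: (boolP (m i <= u)%MM) => //= iu; apply/forallPn; exists j.
by rewrite negb_imply negbK ju andbT ltn_neqAle jmin // andbT eq_sym.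
Qed.

End StanleyBounds.

Section LcmLattice.
Variables (K : fieldType) (n : nat) (J : monomialIdeal K n).
Variables (d : Order.disp_t) (L : finTBLatticeType d).
Local Notation S := {mpoly K[n]}.

Definition atom_val (a : 'I_(num_atoms L)) : L := enum_val a.

Lemma atom_valP a : is_atom (atom_val a).
Proof. exact: (enum_valP a). Qed.

Lemma atom_valK (x : L) : is_atom x -> exists a, atom_val a = x.
Proof. by move=> ax; exists (enum_rank_in ax x); apply: enum_rankK_in. Qed.

Lemma minimal_generator_le (u : 'X_{1..n}) : 'X_[u] \in (J : {pred S}) ->
  exists2 g, minimal_generator J g & (g <= u)%MM.
Proof.
have [e] := ubnP (mdeg u); elim: e u => // e IH u ue uJ.
have [ug|] := pselect (minimal_generator J u); first by exists u => //; apply: lepm_refl.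
move=> nu; have [v [vJ vu vnu]] : exists v, [/\ 'X_[v] \in (J : {pred S}), (v <= u)%MM & v <> u].
  apply: contrapT => no; apply: nu; split=> // v vJ vu.
  by apply: contrapT => vnu; apply: no; exists v.
suff ve : (mdeg v < e)%N.
  by have [g gg gv] := IH v ve vJ; exists g => //; apply: lepm_trans gv vu.
rewrite -ltnS; apply: leq_trans ue; rewrite ltnS -(submK vu) mdegD -add1n leq_add2r lt0n mdeg_eq0.
apply/eqP => /mnmP uv; apply: vnu; apply: lepm_anti => //; apply/mnm_lepP => i.
by have := uv i; rewrite mnmBE mnm0E => /eqP; rewrite subn_eq0.
Qed.

Lemma in_lcm_lattice_generator g : minimal_generator J g -> in_lcm_lattice J g.
Proof.
move=> gg; exists [:: g]; split; first by move=> a; rewrite inE => /eqP->.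
by rewrite big_cons big_nil mlcm0.
Qed.

Lemma generator_neq0 g : minimal_generator J g -> g <> 0%MM.
Proof. by move=> [gJ _] g0; move: gJ; rewrite g0 mpolyX0 idealr1. Qed.

(** The order isomorphism matches atoms with minimal generators and joins with lcms, so redundancy
    can be read off from [L]. *)
Lemma lcm_lattice_iso_gens : lcm_lattice_iso J L ->
  exists m : 'I_(num_atoms L) -> 'X_{1..n},
    (forall u : 'X_{1..n}, 'X_[u] \in (J : {pred S}) <-> exists a, (m a <= u)%MM) /\
    (forall b (B : {set 'I_(num_atoms L)}),
      (m b <= lcms m B)%MM = (atom_val b <= \join_(a in B) atom_val a)%O).
Proof.
move=> [f [fle fP]]; exists (fun a => f (atom_val a)).
have f_inj : injective f.
  by move=> x y e; apply/eqP; rewrite eq_le -!fle e lepm_refl.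
have f0 : f \bot%O = 0%MM.
  have /fP[y y0] : in_lcm_lattice J 0%MM by exists [::]; split=> //; rewrite big_nil.
  apply: lepm_anti; last by apply/mnm_lepP => i; rewrite mnm0E.
  by rewrite -y0 fle le0x.
have f_lcm x : exists2 A : seq 'X_{1..n}, (forall a, a \in A -> minimal_generator J a) &
    f x = \big[@mlcm n/0%MM]_(a <- A) a.
  by have /fP[A [h e]] : exists y, f y = f x; [exists x|exists A].
have le_big (A : seq 'X_{1..n}) a : a \in A -> (a <= \big[@mlcm n/0%MM]_(a <- A) a)%MM.
  move=> aA; have := lepm_refl (\big[@mlcm n/0%MM]_(a <- A) a).
  by rewrite {1}big_mlcm_le => /allP/(_ a aA).
have nonempty x (A : seq 'X_{1..n}) : x != \bot%O -> f x = \big[@mlcm n/0%MM]_(a <- A) a ->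
    exists a, a \in A.
  case: A => [|a A] x0 e; last by exists a; rewrite mem_head.
  by case/eqP: x0; apply: f_inj; rewrite e big_nil f0.
(* A generator occurring in the lcm of an atom's image lies below it and is not 1, so it equals that
   image. *)
have gen a : minimal_generator J (f (atom_val a)).
  have /andP[x0 /forallP xmin] := atom_valP a; set x := atom_val a in x0 xmin *.
  have [A hA e] := f_lcm x; have [g gA] := nonempty _ _ x0 e.
  have /fP[y yg] := in_lcm_lattice_generator (hA g gA).
  suff <- : y = x by rewrite yg; apply: hA.
  apply/eqP; apply/negPn/negP => yx.
  have lt : (y < x)%O by rewrite lt_neqAle yx -fle yg e le_big.
  have := implyP (xmin y) lt => /eqP yb.
  by apply: (generator_neq0 (hA g gA)); rewrite -yg yb f0.
have gens g : minimal_generator J g -> exists a, f (atom_val a) = g.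
  move=> gg; have /fP[x xg] := in_lcm_lattice_generator gg.
  suff /atom_valK[a ax] : is_atom x by exists a; rewrite ax.
  apply/andP; split; first by apply/eqP => x0; apply: (generator_neq0 gg); rewrite -xg x0.
  apply/forallP => y; apply/implyP => yx; apply/negPn/negP => y0.
  have [A hA e] := f_lcm y; have [h hA'] := nonempty _ _ y0 e.
  have hy : (h <= f y)%MM by rewrite e le_big.
  have yg : (f y <= g)%MM by rewrite -xg fle ltW.
  have hg : h = g by apply: (gg.2) (lepm_trans hy yg); have [] := hA h hA'.
  by move: yx; rewrite lt_leAnge -!fle xg -{2}hg hy andbF.
split=> [u|b B].
  split=> [/minimal_generator_le[g /gens[a <-] gu]|[a au]]; first by exists a.
  by rewrite -(submK au) mpolyXD idealMr //; have [] := gen a.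
have [y yB] : exists y, f y = lcms (fun a => f (atom_val a)) B.
  apply/fP; exists [seq f (atom_val a) | a <- index_enum _ & a \in B]; split.
    by move=> g /mapP[a _ ->].
  by rewrite big_map big_filter.
rewrite -yB fle; congr (_ <= _)%O; apply/eqP.
rewrite eq_le -fle yB; apply/andP; split.
  by apply/lcms_le => a aB; rewrite fle; exact: joins_sup.
apply/joinsP => a aB; rewrite -fle yB.
exact: (le_lcms (fun a => f (atom_val a))).
Qed.

End LcmLattice.

(** * Realizing an atomistic lattice as an lcm lattice *)

Section LatticeIdeal.
Variables (K : fieldType) (d : Order.disp_t) (L : finTBLatticeType d).
Local Notation S := {mpoly K[#|L|]}.
Implicit Types (x y z : L) (u v : 'X_{1..#|L|}).

(* One variable per element z of L, dividing the monomial of y iff ~ (y <= z);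
   this turns joins into least common multiples. *)
Definition lattice_monomial y : 'X_{1..#|L|} :=
  [multinom nat_of_bool (~~ (y <= enum_val i)%O) | i < #|L|].

Local Notation g := lattice_monomial.

Lemma lattice_monomial_le y z : (g y <= g z)%MM = (y <= z)%O.
Proof.
(* The variable indexed by [z] is tested: it does not divide [g z]. *)
apply/mnm_lepP/idP => [/(_ (enum_rank z))|yz i]; rewrite !mnmE.
  by rewrite enum_rankK lexx; case: (_ <= _)%O.
by case: (boolP (z <= _)%O) => [/(le_trans yz)->//|_]; apply: leq_b1.
Qed.

Lemma lattice_monomial_join y z : g (y `|` z)%O = mlcm (g y) (g z).
Proof. by apply/mnmP => i; rewrite !mnmE leUx; do 2 case: (_ <= _)%O. Qed.

Lemma lattice_monomial_bot : g \bot%O = 0%MM.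
Proof. by apply/mnmP => i; rewrite !mnmE le0x. Qed.

Definition lattice_ideal_pred : {pred S} :=
  fun p => all (fun u => [exists a, is_atom a && (g a <= u)%MM]) (msupp p).

Lemma lattice_idealX u :
  ('X_[u] \in lattice_ideal_pred) = [exists a, is_atom a && (g a <= u)%MM].
Proof. by rewrite /in_mem /= /lattice_ideal_pred msuppX /= andbT. Qed.

Fact lattice_ideal_closed : idealr_closed lattice_ideal_pred.
Proof.
split.
- by rewrite /in_mem /= /lattice_ideal_pred msupp0.
- rewrite -mpolyX0 lattice_idealX; apply/existsPn => a.
  rewrite -lattice_monomial_bot lattice_monomial_le lex0; apply/negP => /andP[].
  by move=> /andP[/negbTE->].
- move=> c p q /allP hp /allP hq; apply/allP => u /msuppD_le; rewrite mem_cat.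
  move=> /orP[/msuppM_le/allpairsP[[v w] /= [_ /hp/existsP[a /andP[aa aw]] ->]]|/hq //].
  by apply/existsP; exists a; rewrite aa (lepm_trans aw) // lem_addl.
Qed.

HB.instance Definition _ := isIdealr.Build S lattice_ideal_pred lattice_ideal_closed.

Definition lattice_idealr : idealr S := lattice_ideal_pred.

Lemma lattice_ideal_gen (p : S) : p \in lattice_ideal_pred <->
  ideal_span (fun q : S => exists2 u, (exists2 a, is_atom a & u = g a) & q = 'X_[u]) p.
Proof.
split=> [/allP hp|[s [hs ->]]]; last first.
  rewrite big_seq; apply: (@rpred_sum _ lattice_idealr) => -[q r] /hs[u [a aa ->] /= ->].
  apply: (@idealMr _ lattice_idealr).
  by rewrite lattice_idealX; apply/existsP; exists a; rewrite aa lepm_refl.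
have ex u : exists a : L, u \in msupp p -> is_atom a && (g a <= u)%MM.
  have [up|_] := boolP (u \in msupp p); last by exists \bot%O.
  by have /existsP[a h] := hp u up; exists a.
have [al alP] := choice ex.
exists [seq (p@_u *: 'X_[u - g (al u)], 'X_[g (al u)]) | u <- msupp p]; split.
  by move=> q /mapP[u /alP/andP[aa _] ->]; exists (g (al u)) => //; exists (al u).
rewrite big_map {1}[p]mpolyE; apply: eq_big_seq => u /alP/andP[_ h] /=.
by rewrite -scalerAl -mpolyXD submK.
Qed.

Hypothesis atomic : atomistic L.
Hypothesis has_atom : exists a : L, is_atom a.

Definition lattice_ideal : monomialIdeal K #|L|.
Proof.
apply: (@MonomialIdeal _ _ lattice_idealr).
- have [a aa] := has_atom; exists 'X_[g a]; last by rewrite -msupp_eq0 msuppX.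
  by rewrite lattice_idealX; apply/existsP; exists a; rewrite aa lepm_refl.
- exists (fun u => exists2 a, is_atom a & u = g a); exact: lattice_ideal_gen.
Defined.

Lemma lattice_ideal_min u :
  minimal_generator lattice_ideal u <-> exists2 a, is_atom a & u = g a.
Proof.
split=> [[]|[a aa ->]].
  rewrite lattice_idealX => /existsP[a /andP[aa au]] umin; exists a => //.
  apply/esym/umin => //.
  by rewrite lattice_idealX; apply/existsP; exists a; rewrite aa lepm_refl.
split=> [|v]; first by rewrite lattice_idealX; apply/existsP; exists a; rewrite aa lepm_refl.
rewrite lattice_idealX => /existsP[b /andP[ab bv]] va.
have ba : (b <= a)%O by rewrite -lattice_monomial_le (lepm_trans bv).
have eba : b = a.
  apply/eqP/negPn/negP => nba; have /andP[_ /forallP/(_ b)] := aa.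
  rewrite lt_neqAle nba ba /= => b0; have /andP[b0' _] := ab.
  by rewrite b0 in b0'.
by apply: lepm_anti => //; rewrite -eba.
Qed.

Lemma lattice_ideal_iso : lcm_lattice_iso lattice_ideal L.
Proof.
exists g; split=> [x y|u]; first exact: lattice_monomial_le.
split=> [[A [hA ->]]|[x <-]].
  elim: A hA => [|v A IH] hA; first by exists \bot%O; rewrite big_nil lattice_monomial_bot.
  have [|x xE] := IH; first by move=> w wA; apply: hA; rewrite inE wA orbT.
  have /lattice_ideal_min[a _ va] := hA v (mem_head _ _).
  by exists (a `|` x)%O; rewrite big_cons -xE va lattice_monomial_join.
have [A [hA ->]] := atomic x.
exists [seq g a | a <- index_enum _ & a \in A]; split.
  move=> v /mapP[a]; rewrite mem_filter => /andP[/hA aa _] ->.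
  by apply/lattice_ideal_min; exists a.
rewrite big_map big_filter.
exact: (big_morph g lattice_monomial_join lattice_monomial_bot).
Qed.

End LatticeIdeal.

(** * Lattice invariants and the final bounds *)

Lemma is_pdim_exists (R : nzRingType) (M : lmodType R) q :
  has_projective_resolution M q -> exists p, is_pdim M p.
Proof.
move=> Mq; have ex : exists p, `[< has_projective_resolution M p >].
  by exists q; apply/asboolP.
have [p /asboolP Mp pmin] := ex_minnP ex; exists p; split=> // r Mr.
by apply: pmin; apply/asboolP.
Qed.

(** Ensures that [pdimQ] is not the default value: the ideal built from [L] has the Taylor
    resolution, hence a projective dimension. *)
Lemma pdimQ_resolution (K : fieldType) d (L : finTBLatticeType d) :
  atomistic L -> (0 < num_atoms L)%N ->
  exists n (J : monomialIdeal K n),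
    lcm_lattice_iso J L /\ has_projective_resolution {ideal_quot J} (pdimQ K L).
Proof.
move=> atL /card_gt0P[a aa].
have ex : exists a : L, is_atom a by exists a.
have isoJ := lattice_ideal_iso K atL ex.
have [m [memJ _]] := lcm_lattice_iso_gens isoJ.
have [p pJ] := is_pdim_exists (taylor_resolution memJ).
have [|n [J [Jiso [res _]]]] := @classical_sets.xgetPex _ 0%N
    (fun p => exists n (J : monomialIdeal K n),
       lcm_lattice_iso J L /\ is_pdim {ideal_quot J} p).
  by exists p, #|L|, (lattice_ideal K ex).
by exists n, J.
Qed.

Theorem theorem7p1 (K : fieldType) (d : Order.disp_t) (L : finTBLatticeType d)
    (k : nat) :
  atomistic L -> num_atoms L = k -> maximal_lattice K L ->
  (pdimQ K L + 2 = k)%N ->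
  (spdimQ K L <= k - 2)%N /\ (spdimI K L <= k - 1)%N.
Proof.
move=> atL <- _ pk.
have kp : num_atoms L = (pdimQ K L).+2 by rewrite -pk addn2.
have k0 : (0 < num_atoms L)%N by rewrite kp.
have [n0 [J0 [iso0 res]]] := pdimQ_resolution K atL k0.
have [m0 [mem0 le0]] := lcm_lattice_iso_gens iso0.
have [v0 v0V] := redundant_nonempty mem0 kp res.
(* Redundancy is a statement about [L], so it passes from the ideal attaining [pdimQ K L] to any
   other one. *)
have domE n (m : 'I_(num_atoms L) -> 'X_{1..n}) b B :
    (forall b B, (m b <= lcms m B)%MM = (atom_val b <= \join_(a in B) atom_val a)%O) ->
    (m0 b <= lcms m0 B)%MM -> dominated setT m b B.
  by move=> leL h; apply: dominated_lcms; rewrite leL -le0.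
(* For the default value 0 the bounds are trivial; otherwise the value comes from an ideal with lcm
   lattice [L]. *)
split; rewrite /spdimQ /spdimI; case: classical_sets.xgetP => [p _ [n [J [iso ->]]]|//].
- have [m [memJ leJ]] := lcm_lattice_iso_gens iso.
  apply: (spdim_quot_le memJ); apply: (coverable_tree v0V (adj := redundant_edge m0)).
  + by move=> v; rewrite inE; apply: domE.
  + by move=> a b /orP[]; [left|right]; apply: domE.
  + by move=> a b; apply: redundant_linked mem0 _ kp res _ _.
  + by rewrite card_ord; lia.
- have [m [memJ _]] := lcm_lattice_iso_gens iso.
  exact: (spdim_ideal_le memJ).
Qed.
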